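(* Let $M$ be a doubly semi-equivelar map on the torus corresponding to a 2-uniform tiling $T$ of the plane. (1) If $T$ is one of $[3^3.4^2:4^4]_1$, $[3^3.4^2:4^4]_2$, $[3^6:3^3.4^2]_1$, $[3^6:3^3.4^2]_2$, $[3^3.4^2:3^2.4.3.4]_1$, $[3^3.4^2:3^2.4.3.4]_2$, $[3^6:3^2.4.3.4]$, $[3.4^2.6:3.6.3.6]_1$, $[3.4^2.6:3.6.3.6]_2$, $[3^2.6^2:3.6.3.6]$, $[3^6:3^2.6^2]$, $[3^4.6:3^2.6^2]$, $[3^2.4.3.4:3.4.6.4]$, $[3^6:3^4.6]_1$, $[3^6:3^4.6]_2$, $[3^3.4^2:3.4.6.4]$, $[3^6:3^2.4.12]$ or $[3.4^2.6:3.4.6.4]$, then $M$ is 4-connected. (2) If $T$ is $[3.4.3.12:3.12^2]$ or $[3.4.6.4:4.6.12]$, then $M$ is 3-connected.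
   Context: Maps. A map $M$ on a closed surface $F$ is an embedding of a simple connected (finite) graph $G$ into $F$ such that the closure of each component of $F\setminus G$ is a $p$-gonal 2-disk $D_p$ ($p\ge 3$), called a face, and the non-empty intersection of any two distinct faces is either a vertex or an edge. $G$ is the underlying graph of $M$. The same notions are used for (infinite, locally finite) maps on the plane. Connectivity. A graph $G$ is $k$-connected if the removal of any $k-1$ vertices leaves a non-trivial connected graph. A map is $k$-connected if its underlying graph is $k$-connected. Face-sequences and links. The face-sequence of a vertex $v$ is the cyclic sequence $(p_1^{n_1},\ldots,p_k^{n_k})$ such that $n_1$ faces $D_{p_1}$, then $n_2$ faces $D_{p_2}$, ..., then $n_k$ faces $D_{p_k}$ occur around $v$ in this cyclic order (sequences are considered up to rotation and reversal). The union of all faces incident at $v$ is a 2-disk; its boundary cycle is the link $\mathrm{lk}(v)=C_k(v_1,\ldots,v_k)$, and the face-sequence of the link is the cyclic sequence $(f_{seq}(v_1),\ldots,f_{seq}(v_k))$ of face-sequences of its vertices (again up to rotation and reversal). Doubly semi-equivelar maps. A map $M$ whose vertices have precisely two distinct face-sequences $f_1,f_2$ is a doubly semi-equivelar map (DSEM) if all vertices with face-sequence $f_1$ have the same face-sequence of the link $(f_{11},\ldots,f_{1k_1})$ and all vertices with face-sequence $f_2$ have the same face-sequence of the link $(f_{21},\ldots,f_{2k_2})$. Its type is $[f_1^{(f_{11},\ldots,f_{1k_1})}:f_2^{(f_{21},\ldots,f_{2k_2})}]$. 2-uniform tilings. A 2-uniform tiling is an edge-to-edge tiling of the plane by regular polygons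 whose vertices form exactly two orbits under its symmetry group. There are exactly twenty of them, namely those listed in (1) and (2); each is a DSEM on the plane. They are denoted by the two face-sequences occurring at their vertices (with dots in place of commas), with subscripts $1,2$ distinguishing the two different tilings having the same pair of face-sequences. A DSEM on the torus corresponds to a 2-uniform tiling $T$ if it has the same type as $T$. *)

(* Defs.v *)
From HB Require Import structures.
From mathcomp Require Import all_boot all_order all_algebra.
From mathcomp Require Import all_classical all_reals all_analysis.

Set Implicit Arguments.
Unset Strict Implicit.
Unset Printing Implicit Defensive.

Import Order.TTheory GRing.Theory Num.Theory.

(* A cell structure on an oriented surface is a family F : I -> seq V: the    *)
(* face i is bounded by the cycle F i of vertices, listed counterclockwise    *)
(* from an arbitrary starting point.  The same encoding serves finite maps on *)
(* the torus and tilings of the plane (where V is the set of points).         *)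

(* Equality of cyclic sequences up to rotation and reversal. *)
Definition dihedral (A : Type) (s t : seq A) : Prop :=
  exists k, t = rot k s \/ t = rot k (rev s).

Section CellStructures.
Variables (V I : eqType) (F : I -> seq V).

Definition is_vertex (v : V) : Prop := exists i, v \in F i.

(* s lists the faces at v in their counterclockwise order around v.  Face i   *)
(* occupies the angle from the edge (v, next) to the edge (v, prev), so the   *)
(* face that comes after i is the one that leaves v along the latter edge.    *)
Definition star (v : V) (s : seq I) : Prop :=
  [/\ s != [::], uniq s, (forall i, (i \in s) = (v \in F i))
    & cycle [rel i j | next (F j) v == prev (F i) v] s].

Definition has_fseq (v : V) (f : seq nat) : Prop :=
  exists2 s, star v s & dihedral [seq size (F i) | i <- s] f.

(* Boundary cycle of the union of the faces in s.  Reading face i from v as   *)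
(* v, b, ..., a, it contributes the part after b: b is the last vertex        *)
(* contributed by the face before i.                                          *)
Definition link (v : V) (s : seq I) : seq V :=
  flatten [seq behead (behead (rot (index v (F i)) (F i))) | i <- s].

Definition has_link_fseq (v : V) (L : seq (seq nat)) : Prop :=
  exists s w, [/\ star v s, dihedral (link v s) w, size w = size L
    & forall k, (k < size L)%N -> has_fseq (nth v w k) (nth [::] L k)].

Definition two_fseqs (f1 f2 : seq nat) : Prop :=
  [/\ ~ dihedral f1 f2, (exists v, has_fseq v f1), (exists v, has_fseq v f2)
    & forall v, is_vertex v -> has_fseq v f1 \/ has_fseq v f2].

(* The type [f1^L1 : f2^L2]. *)
Definition dsem_type (f1 : seq nat) (L1 : seq (seq nat))
    (f2 : seq nat) (L2 : seq (seq nat)) : Prop :=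
  [/\ two_fseqs f1 f2,
      (forall v, has_fseq v f1 -> has_link_fseq v L1)
    & (forall v, has_fseq v f2 -> has_link_fseq v L2)].

Definition doubly_semi_equivelar : Prop :=
  exists f1 L1 f2 L2, dsem_type f1 L1 f2 L2.

End CellStructures.

Definition same_type (V I W J : eqType) (F : I -> seq V) (G : J -> seq W) :
    Prop :=
  exists f1 L1 f2 L2, dsem_type F f1 L1 f2 L2 /\ dsem_type G f1 L1 f2 L2.

Section FiniteMaps.
Variables (V I : finType) (M : I -> seq V).

(* Every edge of a map lies on a face, so the underlying graph can be read    *)
(* off the faces.                                                             *)
Definition adj : rel V := fun u v =>
  [exists i, [&& u \in M i, v \in M i
               & (next (M i) u == v) || (next (M i) v == u)]].

Definition edges : {set {set V}} :=
  [set e | [exists u, exists v, adj u v && (e == [set u; v])]].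

Definition common (i j : I) : {set V} := [set x in M i] :&: [set x in M j].

(* Two faces meet in at most a vertex, or in one edge traversed by them in    *)
(* opposite directions; in the second case they have no other common vertex,  *)
(* and they share the edge itself rather than its endpoints only.             *)
Definition proper_intersection (i j : I) : Prop :=
  (#|common i j| <= 1)%N \/
  exists2 x, x \in M i & common i j = [set x; next (M i) x] /\
                         next (M j) (next (M i) x) = x.

(* Maps on closed connected orientable surfaces.  om_coherent says that the   *)
(* face boundaries are coherently oriented and, together with om_star, that   *)
(* every edge is on exactly two faces and that the faces around every vertex  *)
(* form a disk.                                                               *)
Record oriented_map : Prop := OrientedMap {
  om_nonempty : (0 < #|V|)%N;
  om_polygon : forall i, uniq (M i) && (2 < size (M i))%N;
  om_coherent : forall i j v, v \in M i -> v \in M j ->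
    next (M i) v = next (M j) v -> i = j;
  om_star : forall v, exists s, star M v s;
  om_proper : forall i j, i != j -> proper_intersection i j;
  om_connected : forall u v, connect adj u v
}.

(* The torus is the closed connected orientable surface of Euler              *)
(* characteristic |V| - |E| + |F| = 0.                                        *)
Definition torus_map : Prop :=
  oriented_map /\ (#|V| + #|I| = #|edges|)%N.

End FiniteMaps.

(* The removal of any k - 1 vertices leaves a connected graph with more than  *)
(* one vertex; the first condition excludes graphs having fewer than k - 1    *)
(* vertices to remove.                                                        *)
Definition k_connected (V : finType) (e : rel V) (k : nat) : Prop :=
  (k.-1 <= #|V|)%N /\
  forall S : {set V}, #|S| = k.-1 ->
    (1 < #|~: S|)%N /\
    forall u v, u \notin S -> v \notin S ->
      connect [rel x y | [&& x \notin S, y \notin S & e x y]] u v.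

Definition map_k_connected (V I : finType) (M : I -> seq V) (k : nat) : Prop :=
  k_connected (adj M) k.

Local Open Scope ring_scope.

Section Tilings.
Variable R : realType.

(* The norm that the library puts on R * R is the sup norm; Euclidean         *)
(* distances are given by this square.                                        *)
Definition sqdist (p q : R * R) : R := (p.1 - q.1) ^+ 2 + (p.2 - q.2) ^+ 2.

Definition cross (u v : R * R) : R := u.1 * v.2 - u.2 * v.1.

Definition segment (p q : R * R) : set (R * R) :=
  [set x | exists t : R, [/\ 0 <= t, t <= 1
    & x = ((1 - t) * p.1 + t * q.1, (1 - t) * p.2 + t * q.2)]]%classic.

(* Vertices of a regular n-gon with circumcentre c and circumradius r, in     *)
(* counterclockwise order.                                                    *)
Definition regular_polygon (s : seq (R * R)) : Prop :=
  exists (n : nat) (c : R * R) (r theta : R), [/\ (3 <= n)%N, 0 < r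
    & s = mkseq (fun k => (c.1 + r * cos (theta + 2 * pi * k%:R / n%:R),
                           c.2 + r * sin (theta + 2 * pi * k%:R / n%:R))) n].

(* The closed, resp. open, convex polygon with counterclockwise vertex list   *)
(* s, as the set of points to the left of all its sides.                      *)
Definition region (s : seq (R * R)) : set (R * R) :=
  [set x | forall p, p \in s -> 0 <= cross (next s p - p) (x - p)]%classic.

Definition open_region (s : seq (R * R)) : set (R * R) :=
  [set x | forall p, p \in s -> 0 < cross (next s p - p) (x - p)]%classic.

Section Family.
Variables (J : eqType) (T : J -> seq (R * R)).

Record regular_tiling : Prop := RegularTiling {
  rt_regular : forall j, regular_polygon (T j);
  rt_cover : forall x, exists j, region (T j) x;
  rt_disjoint : forall i j, i <> j ->
    (open_region (T i) `&` open_region (T j) = set0)%classic;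
  rt_locally_finite : forall r : R, finite_set
    [set j | exists2 x, region (T j) x & sqdist x 0 <= r]%classic;
  rt_edge_to_edge : forall i j, i <> j ->
    [\/ (region (T i) `&` region (T j) = set0)%classic,
        (exists p, [/\ p \in T i, p \in T j
           & (region (T i) `&` region (T j) = [set p])%classic])
      | (exists p q, [/\ p \in T i, q \in T j, next (T i) p = q,
             next (T j) q = p
           & (region (T i) `&` region (T j) = segment p q)%classic])]
}.

Definition tiling_symmetry (g : R * R -> R * R) : Prop :=
  [/\ (forall x y, sqdist (g x) (g y) = sqdist x y),
      (forall i, exists j, (g @` region (T i) = region (T j))%classic)
    & (forall j, exists i, (g @` region (T i) = region (T j))%classic)].

Definition same_orbit (x y : R * R) : Prop :=
  exists2 g, tiling_symmetry g & g x = y.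

Definition two_uniform : Prop :=
  regular_tiling /\
  exists a b, [/\ is_vertex T a, is_vertex T b, ~ same_orbit a b
    & forall v, is_vertex T v -> same_orbit a v \/ same_orbit b v].

(* T is one of the tilings denoted [f1 : f2], with or without subscript, for  *)
(* a pair (f1, f2) of the list.                                               *)
Definition tiling_among (l : seq (seq nat * seq nat)) : Prop :=
  exists2 f, f \in l & two_fseqs T f.1 f.2.

End Family.
End Tilings.

(* Where two tilings share a pair of face-sequences and are told apart by the *)
(* subscripts 1 and 2, both belong to the same list; such a pair is entered   *)
(* once and stands for both.                                                  *)
Definition four_connected_tilings : seq (seq nat * seq nat) := [::
  ([:: 3; 3; 3; 4; 4],    [:: 4; 4; 4; 4]);     (* subscripts 1 and 2 *)
  ([:: 3; 3; 3; 3; 3; 3], [:: 3; 3; 3; 4; 4]);  (* subscripts 1 and 2 *)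
  ([:: 3; 3; 3; 4; 4],    [:: 3; 3; 4; 3; 4]);  (* subscripts 1 and 2 *)
  ([:: 3; 3; 3; 3; 3; 3], [:: 3; 3; 4; 3; 4]);
  ([:: 3; 4; 4; 6],       [:: 3; 6; 3; 6]);     (* subscripts 1 and 2 *)
  ([:: 3; 3; 6; 6],       [:: 3; 6; 3; 6]);
  ([:: 3; 3; 3; 3; 3; 3], [:: 3; 3; 6; 6]);
  ([:: 3; 3; 3; 3; 6],    [:: 3; 3; 6; 6]);
  ([:: 3; 3; 4; 3; 4],    [:: 3; 4; 6; 4]);
  ([:: 3; 3; 3; 3; 3; 3], [:: 3; 3; 3; 3; 6]);  (* subscripts 1 and 2 *)
  ([:: 3; 3; 3; 4; 4],    [:: 3; 4; 6; 4]);
  ([:: 3; 3; 3; 3; 3; 3], [:: 3; 3; 4; 12]);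
  ([:: 3; 4; 4; 6],       [:: 3; 4; 6; 4])
]%N.

Definition three_connected_tilings : seq (seq nat * seq nat) := [::
  ([:: 3; 4; 3; 12],      [:: 3; 12; 12]);
  ([:: 3; 4; 6; 4],       [:: 4; 6; 12])
]%N.

(* Main.v *)
Require Import Defs.
From mathcomp Require Import all_classical all_reals all_analysis.
From mathcomp Require Import all_boot all_order all_algebra.
From mathcomp Require Import perm zify lra.

Set Implicit Arguments.
Unset Strict Implicit.
Unset Printing Implicit Defensive.

Import Order.TTheory GRing.Theory Num.Theory.

(** The proof reads off the type of M the multiset of face sizes at each vertex:
    it is that of one of the two face-sequences listed for T
    ([same_type_fseqs]).

    3-connectedness holds in every polyhedral map.  Suppose that deleting a
    minimal set S of vertices separates A from B, and let a be in S.  Then a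
    has neighbours on both sides, so going once around a the side must change
    at least twice.  A change takes place at a face that contains another
    vertex b of S, and because two faces share at most an edge, each such b
    accounts for a single change.  Hence S has at least three vertices
    ([cut_size_ge3]), and if it has exactly three, then each of them sees A in
    one single interval of its link ([cut3_crossing]).

    For 4-connectedness take such a cut S of three vertices.  The curve that
    runs through S and the three faces separating A from B bounds a disk on the
    torus, and the count below is the Gauss-Bonnet formula of that disk.
    Let e be the number of edges with an end in A and f the number of faces
    lying on the side of A.  The embedded graph formed by these e edges has
    |A| + 3 vertices and, as the curve has one piece, f + 1 boundary
    components.  Its Euler characteristic is even, because the sign of a
    permutation is determined by its number of cycles; so e - |A| - f is even
    ([cut_side_parity]).

    On the other hand, regular polygons with the sizes of the faces fit around
    each vertex, so e - |A| - f is a sum over the faces of angles on the side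
    of A (measured in turns) and of terms coming from the curve ([excess]).
    The two sides together give at most 6, and each gives at least 2, so one
    of them gives exactly 2 ([no_cut3]).  The bound 2 rests on the inequality
    1/p + 1/q >= 1/3, valid for any two faces at a vertex.  In the case of
    equality some vertex on that side lies on no face other than the three
    faces of the curve ([excess_eq2_degree]), whereas all degrees are at least
    4. *)

(** * Counting the orbits of a permutation by labels *)

Lemma eq_card_imset (T L1 L2 : finType) (A : {pred T}) (f : T -> L1)
    (g : T -> L2) :
    (forall x y, x \in A -> y \in A -> (f x == f y) = (g x == g y)) ->
  #|[set f x | x in A]| = #|[set g x | x in A]|.
Proof.
move=> fg.
have [x0 Ax0 | A0] := pickP A; last first.
  have imA0 (L : finType) (h : T -> L) : #|[set h x | x in A]| = 0.
    by apply/eqP; rewrite -leqn0 (leq_trans (leq_imset_card _ _)) ?eq_card0.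
  by rewrite !imA0.
pose h z := g (odflt x0 [pick x in A | f x == z]).
have hf x : x \in A -> h (f x) = g x.
  rewrite /h => Ax; case: pickP => [y /andP[Ay fyx] /= | /(_ x)].
    by apply/eqP; rewrite -fg.
  by rewrite Ax eqxx.
rewrite -(_ : h @: (f @: A) = g @: A).
  apply/esym/card_in_imset => _ _ /imsetP[x Ax ->] /imsetP[y Ay ->].
  by rewrite !hf // => /eqP; rewrite -fg // => /eqP.
by rewrite -imset_comp; apply: eq_in_imset => x Ax /=; rewrite hf.
Qed.

Lemma fconnect_ind (T : finType) (g : T -> T) (x : T) (P : T -> Prop) :
    P x -> (forall y, P y -> P (g y)) -> forall y, fconnect g x y -> P y.
Proof.
move=> Px Pg y /iter_findex <-.
by elim: (findex g x y) => //= n IHn; apply: Pg.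
Qed.

(** The label l is a complete invariant of the orbits of g in D.  Asking that
    two points with the same label have a common iterate, instead of being
    iterates of each other, spares walking all the way around an orbit. *)
Definition orbit_labels (T L : finType) (D : {set T}) (g : T -> T)
    (l : T -> L) : Prop :=
  (forall x, x \in D -> l (g x) = l x) /\
  (forall x y, x \in D -> y \in D -> l x = l y ->
     exists2 z, fconnect g x z & fconnect g y z).

Section Parity.
Variables (T : finType) (D : {set T}).

(** Outside D the extension is the identity, so that a permutation of D becomes
    one of T and has a sign. *)
Definition extend (g : T -> T) : T -> T := fun x => if x \in D then g x else x.

Section OneMap.
Variable g : T -> T.
Hypothesis gD : forall x, x \in D -> g x \in D.
Hypothesis g_inj : {in D &, injective g}.

Lemma extend_inj : injective (extend g).
Proof.
move=> x y; rewrite /extend; case: ifP => Dx; case: ifP => Dy.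
- exact: g_inj.
- by move=> gxy; rewrite -gxy gD in Dy.
- by move=> xgy; rewrite xgy gD in Dx.
- by [].
Qed.

Lemma fconnect_extend x : x \in D ->
  forall y, fconnect g x y -> (y \in D) && (y \in porbit (perm extend_inj) x).
Proof.
move=> Dx y; elim/fconnect_ind: y / => [|y]; first by rewrite Dx porbit_id.
case/andP=> Dy /porbitP[n def_y]; rewrite gD //=; apply/porbitP; exists n.+1.
by rewrite expgSr permM -def_y permE /extend Dy.
Qed.

Lemma card_porbits_labels (L : finType) (l : T -> L) : orbit_labels D g l ->
  #|porbits (perm extend_inj)| = #|~: D| + #|l @: D|.
Proof.
case=> lg lP; set p := perm _.
have pD x : x \in D -> (p x \in D) && (l (p x) == l x).
  by move=> Dx; rewrite permE /extend Dx gD //= lg.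
have orbD x y : x \in D -> y \in porbit p x -> (y \in D) && (l y == l x).
  move=> Dx /porbitP[n ->]; elim: n => [|n /andP[IHn /eqP<-]].
    by rewrite expg0 perm1 Dx eqxx.
  by rewrite expgSr permM pD.
have orbND x y : x \notin D -> y \in porbit p x -> y = x.
  move=> Dx /porbitP[n ->]; elim: n => [|n IHn]; first by rewrite expg0 perm1.
  by rewrite expgSr permM IHn permE /extend (negPf Dx).
pose m x : T + L := if x \in D then inr (l x) else inl x.
have -> : #|porbits p| = #|m @: [set: T]|.
  rewrite /porbits; transitivity #|[set m x | x in predT]|; last first.
    by apply: eq_card => z; apply/imsetP/imsetP => -[x _ ->];
      exists x; rewrite ?inE.
  apply: eq_card_imset => x y _ _; rewrite eq_porbit_mem /m.
  case: ifPn => Dx; case: ifPn => Dy.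
  - apply/idP/eqP => [/(orbD _ _ Dy)/andP[_ /eqP->] // | [lxy]].
    have [z xz yz] := lP x y Dx Dy lxy.
    have /andP[_] := fconnect_extend Dx xz; rewrite porbit_sym => zx.
    have /andP[_] := fconnect_extend Dy yz.
    by rewrite -!eq_porbit_mem in zx * => /eqP<-.
  - by apply/negbTE/negP => /(orbND _ _ Dy) xy; rewrite xy (negPf Dy) in Dx.
  - by apply/negbTE/negP => /(orbD _ _ Dy)/andP[xD]; rewrite xD in Dx.
  - apply/idP/eqP => [/(orbND _ _ Dy)-> // | [->]]; exact: porbit_id.
have mE : m @: [set: T] = (inl @: (~: D)) :|: (inr @: (l @: D)).
  apply/setP => -[x|z]; rewrite !inE.
    rewrite mem_imset; last by move=> ? ? [].
    rewrite [X in _ || X](_ : _ = false) ?orbF ?inE; last first.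
      by apply/imsetP => -[].
    apply/imsetP/idP => [[y _] | Dx].
      by rewrite /m; case: ifPn => // Dy [->].
    by exists x => //; rewrite /m (negPf Dx).
  rewrite [X in X || _](_ : _ = false) /=; last by apply/imsetP => -[].
  rewrite mem_imset; last by move=> ? ? [].
  apply/imsetP/imsetP => -[x Dx]; rewrite /m.
    by case: ifPn => // {}Dx [->]; exists x.
  by move=> ->; exists x; rewrite ?inE ?Dx.
rewrite mE cardsU (_ : _ :&: _ = set0) ?cards0 ?subn0; last first.
  apply/setP => z; rewrite !inE; apply/andP => -[/imsetP[x _ ->]].
  by case/imsetP.
have inl_inj : injective (@inl T L) by move=> ? ? [].
have inr_inj : injective (@inr T L) by move=> ? ? [].
by rewrite (card_imset _ inl_inj) (card_imset _ inr_inj).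
Qed.
End OneMap.

(** The parity of the Euler characteristic of an oriented surface: if D is the
    set of darts of an embedded graph, with s, f and a turning around vertices,
    walking along faces and reversing edges, then V + E + F is even.  Indeed
    a is the composite of f and s, and a permutation with c cycles on n points
    has the sign of n - c; the fixed points outside D are counted alike for
    the three permutations. *)
Lemma orbit_count_parity (s f a : T -> T) (Ls Lf : finType)
    (ls : T -> Ls) (lf : T -> Lf) :
    (forall x, x \in D -> [/\ s x \in D, f x \in D & a x \in D]) ->
    (forall x, x \in D -> [/\ a (a x) = x, a x != x & s (f x) = a x]) ->
    orbit_labels D s ls -> orbit_labels D f lf ->
  exists e, #|D| = e.*2 /\ ~~ odd (#|ls @: D| + e + #|lf @: D|).
Proof.
move=> DD aP sl fl.
have sD x : x \in D -> s x \in D by case/DD.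
have fD x : x \in D -> f x \in D by case/DD.
have aD x : x \in D -> a x \in D by case/DD.
have a_inj : {in D &, injective a}.
  by move=> x y /aP[ax _ _] /aP[ay _ _] axy; rewrite -ax axy ay.
have f_inj : {in D &, injective f}.
  move=> x y Dx Dy fxy; apply: a_inj => //.
  by case: (aP _ Dx) => _ _ <-; case: (aP _ Dy) => _ _ <-; rewrite fxy.
pose pf := perm (extend_inj fD f_inj); pose pa := perm (extend_inj aD a_inj).
have s_onto x : x \in D -> exists2 y, y \in D & x = f y.
  move=> Dx; exists (pf^-1%g x).
    rewrite -[_ \in D]negbK; apply/negP => Dy.
    have := permKV pf x; rewrite permE /extend (negPf Dy) => xE.
    by rewrite xE Dx in Dy.
  have := permKV pf x; rewrite permE /extend; case: ifP => // Dy xE.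
  by rewrite xE Dx in Dy.
have s_inj : {in D &, injective s}.
  move=> _ _ /s_onto[x Dx ->] /s_onto[y Dy ->].
  case: (aP _ Dx) (aP _ Dy) => _ _ -> [_ _ ->] axy.
  by rewrite (a_inj x y).
pose ps := perm (extend_inj sD s_inj).
have sfa : (pf * ps)%g = pa.
  apply/permP => x; rewrite permM !permE /extend.
  have [Dx | /negPf Dx] := boolP (x \in D); last by rewrite Dx.
  by rewrite fD //; case: (aP _ Dx).
have [e De al] : exists2 e, #|D| = e.*2 & #|porbits pa| = #|~: D| + e.
  pose la x := [set x; a x].
  have la_fiber x y : x \in D -> la x = la y -> y = x \/ y = a x.
    move=> Dx lxy; have : y \in la x by rewrite lxy !inE eqxx.
    by rewrite !inE => /orP[] /eqP; [left | right].
  exists #|la @: D|; last first.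
    apply: card_porbits_labels; split=> [x Dx | x y Dx Dy].
      by case: (aP _ Dx) => ax _ _; rewrite /la ax setUC.
    case/la_fiber => // ->; first by exists x.
    by exists (a x) => //; apply: fconnect1.
  rewrite -muln2 -sum_nat_const -sum1_card (partition_big_imset la) /=.
  apply: eq_bigr => _ /imsetP[x Dx ->].
  case: (aP _ Dx) => aax ax _.
  rewrite sum1dep_card -[2](_ : #|[set x; a x]| = 2); last first.
    by rewrite cards2 eq_sym ax.
  apply: eq_card => y; rewrite !inE; apply/andP/orP => [[Dy /eqP lyx] | ].
    by case: (la_fiber _ _ Dx (esym lyx)) => ->; rewrite eqxx; [left | right].
  case=> /eqP->; rewrite ?aD ?Dx ?eqxx //; split=> //.
  by rewrite /la aax setUC.
exists e; split=> //.
have /(congr1 (@odd_perm T)) := sfa.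
rewrite odd_permM /odd_perm al (card_porbits_labels _ _ sl).
rewrite (card_porbits_labels _ _ fl).
have := cardsC D; rewrite De; lia.
Qed.
End Parity.

(** * Faces and rotations of an oriented map *)

Lemma cycle_ind (T : eqType) (s : seq T) (P : T -> Prop) (x : T) :
    uniq s -> x \in s -> P x ->
    (forall y, y \in s -> P y -> P (next s y)) ->
  forall y, y \in s -> P y.
Proof.
move=> Us sx Px nextP y sy.
have /rot_to[i s' s_rot] := sx.
have Us' : uniq (x :: s') by rewrite -s_rot rot_uniq.
have nextE z : next (x :: s') z = next s z by rewrite -s_rot next_rot.
have {sy} : y \in x :: s' by rewrite -s_rot mem_rot.
have memE z : (z \in x :: s') = (z \in s) by rewrite -s_rot mem_rot.
move=> sy; rewrite -(nth_index x sy).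
have : index y (x :: s') < size (x :: s') by rewrite index_mem.
elim: (index y _) => [// | n IHn] n_lt.
have := IHn (ltnW n_lt); have s'n := mem_nth x (ltnW n_lt).
rewrite memE in s'n; move/(nextP _ s'n).
by rewrite -nextE next_nth mem_nth ?(ltnW n_lt) // index_uniq // ltnW.
Qed.

Section Map.
Variables (V I : finType) (M : I -> seq V).
Hypothesis omM : oriented_map M.

Local Notation nx i v := (next (M i) v).
Local Notation pv i v := (prev (M i) v).

Lemma face_uniq i : uniq (M i). Proof. by case/andP: (om_polygon omM i). Qed.
Lemma face_size i : 2 < size (M i). Proof. by case/andP: (om_polygon omM i). Qed.

Lemma prevK i : cancel (prev (M i)) (next (M i)).
Proof. exact: next_prev (face_uniq i). Qed.
Lemma nextK i : cancel (next (M i)) (prev (M i)).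
Proof. exact: prev_next (face_uniq i). Qed.

Lemma next_neq i v : v \in M i -> nx i v != v.
Proof.
move=> iv; apply/eqP => fix_v; have := face_size i.
have sub : {subset M i <= [:: v]}.
  apply: (@cycle_ind _ _ (fun w => w \in [:: v]) v) => //; rewrite ?inE //.
    exact: face_uniq.
  by move=> y _; rewrite inE => /eqP->; rewrite fix_v inE.
have := uniq_leq_size (face_uniq i) sub; rewrite /=; lia.
Qed.

(** The next face counterclockwise around v.  It is found by its defining
    property, so that no star of v has to be chosen. *)
Definition turn (v : V) (i : I) : I :=
  odflt i [pick j | (v \in M j) && (nx j v == pv i v)].

Lemma turnP v i : v \in M i -> v \in M (turn v i) /\ nx (turn v i) v = pv i v.
Proof.
move=> iv; rewrite /turn; case: pickP => [j /andP[jv /eqP] // | no_j].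
have [s [_ Us sP s_cycle]] := om_star omM v.
have si : i \in s by rewrite sP.
have := next_cycle s_cycle si; rewrite /= => nj.
have := no_j (next s i); rewrite nj -sP mem_next si //.
Qed.

Lemma turn_eq v i j : v \in M i -> v \in M j -> nx j v = pv i v -> turn v i = j.
Proof.
move=> iv jv nj; have [tv nt] := turnP iv.
by apply: (om_coherent omM tv jv); rewrite nt.
Qed.

Lemma turn_ind v (P : I -> Prop) i : v \in M i -> P i ->
    (forall j, v \in M j -> P j -> P (turn v j)) ->
  forall j, v \in M j -> P j.
Proof.
have [s [_ Us sP s_cycle]] := om_star omM v.
move=> iv Pi Pturn j; rewrite -sP; move: j.
apply: (@cycle_ind _ s P i) => //; first by rewrite sP.
move=> j sj Pj; have jv : v \in M j by rewrite -sP.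
suff <- : turn v j = next s j by apply: Pturn.
apply: turn_eq => //; first by rewrite -sP mem_next.
exact/eqP/(next_cycle s_cycle sj).
Qed.

Lemma face_ex v : exists i, v \in M i.
Proof.
have [[|i s] [//= _ _ sP _]] := om_star omM v.
by exists i; rewrite -sP mem_head.
Qed.

Lemma adj_next i v : v \in M i -> adj M v (nx i v).
Proof.
by move=> iv; apply/existsP; exists i; rewrite iv mem_next iv eqxx.
Qed.

Lemma adj_sym u v : adj M u v = adj M v u.
Proof.
by apply: eq_existsb => i; rewrite orbC andbCA.
Qed.

Lemma adjP u v : adj M u v -> exists2 i, u \in M i & nx i u = v.
Proof.
case/existsP => i /and3P[iu iv /orP[/eqP n_u | /eqP n_v]]; first by exists i.
have [tu nt] := turnP iu; exists (turn u i) => //.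
by rewrite nt -n_v nextK.
Qed.

Lemma adj_prev i v : v \in M i -> adj M v (pv i v).
Proof.
by move=> iv; rewrite adj_sym -{2}(prevK i v) adj_next // mem_prev.
Qed.

(** * Vertex cuts *)

(** The three sets partition the vertices; saying so by a sum of truth values
    lets arithmetic and case analysis decide membership. *)
Record cut (S A B : {set V}) : Prop := Cut {
  cut_color : forall v, (v \in S) + (v \in A) + (v \in B) = 1;
  cut_adj : forall u v, adj M u v -> u \in A -> v \notin B;
  cut_left : 0 < #|A|;
  cut_right : 0 < #|B|
}.

Lemma cut_sym S A B : cut S A B -> cut S B A.
Proof.
case=> color noAB A0 B0; split=> // [v | u v].
  by rewrite addnAC.
by rewrite adj_sym => /noAB vu Bu; apply/negP => /vu; rewrite Bu.
Qed.

Lemma no_cut_k_connected k : k.-1.+1 < #|V| ->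
    (forall S A B : {set V}, #|S| = k.-1 -> ~ cut S A B) ->
  map_k_connected M k.
Proof.
move=> V_gt no_cut; split=> [|S S_k]; first by rewrite ltnW // ltnW.
split=> [|u v Su Sv]; first by have := cardsC S; lia.
pose e := [rel x y | [&& x \notin S, y \notin S & adj M x y]].
rewrite -/e; have [//|not_uv] := boolP (connect e u v).
(* One side is the component of u, the other one consists of the rest. *)
case: (@no_cut S [set x | connect e u x]
                 [set x | (x \notin S) && ~~ connect e u x]) => //.
have conn_notS x : connect e u x -> x \notin S.
  case/connectP=> p; case/lastP: p => [_ -> // | p y].
  by rewrite rcons_path last_rcons /= => /andP[_ /and3P[_ Sy _]] ->.
split=> [x | x y xy | |].
- rewrite !inE; have := conn_notS x.
  by case: (connect e u x) => [/(_ isT)/negPf-> // | _]; case: (x \in S).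
- rewrite !inE => ux; apply/negP => /andP[Sy /negP]; apply.
  apply: (connect_trans ux); apply: connect1.
  by rewrite /= xy Sy conn_notS.
- by apply/card_gt0P; exists u; rewrite inE.
- by apply/card_gt0P; exists v; rewrite inE Sv.
Qed.

(** A cut vertex that has no neighbour in A can be handed over to B.  This is
    how minimality of a cut is used. *)
Lemma cut_drop S A B a : cut S A B -> a \in S ->
    (forall i, a \in M i -> nx i a \notin A) ->
  cut (S :\ a) A (a |: B).
Proof.
move=> [color noAB A0 B0] Sa noA; split=> // [v | u v uv Au |].
- rewrite !inE; have := color v; have := color a; rewrite Sa.
  by case: eqP => [-> | _] /=; [rewrite Sa; lia | lia].
- rewrite !inE negb_or (noAB u) // andbT; apply/eqP => v_a; rewrite {}v_a in uv.
  rewrite adj_sym in uv; have [i ia n_a] := adjP uv.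
  by have := noA i ia; rewrite n_a Au.
- by rewrite card_gt0; apply/set0Pn; exists a; rewrite !inE eqxx.
Qed.

Lemma cut_nonempty S A B : cut S A B -> 0 < #|S|.
Proof.
move=> [color noAB /card_gt0P[u Au] /card_gt0P[v Bv]].
rewrite lt0n; apply/eqP => /cards0_eq S0.
have /connectP[p] := om_connected omM u v.
elim: p u Au => [|w p IHp] u Au /= => [_ vu | /andP[uw wp]].
  by have := color v; rewrite Bv vu Au; lia.
apply: IHp => //; have := color w; rewrite S0 inE.
by have /negPf-> := noAB u w uw Au; case: (w \in A).
Qed.

(** * How a cut looks from one of its vertices *)

Definition leaves (A : {set V}) (a : V) (i : I) : bool :=
  [&& a \in M i, pv i a \in A & nx i a \notin A].
Definition enters (A : {set V}) (a : V) (i : I) : bool :=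
  [&& a \in M i, pv i a \notin A & nx i a \in A].

(** Going around a, the side cannot switch from A to its complement without
    switching back. *)
Lemma leaves_enters_ex (A : {set V}) a i j :
    a \in M i -> nx i a \in A -> a \in M j -> nx j a \notin A ->
  (exists k, leaves A a k) /\ (exists k, enters A a k).
Proof.
move=> ia iA ja jA; split; apply/existsP; apply: contraT => /existsPn none.
  suff: nx i a \notin A by rewrite iA.
  apply: (@turn_ind a (fun k => nx k a \notin A) j) => // k ka kA.
  have [_ ->] := turnP ka.
  by have := none k; rewrite /leaves ka kA andbT.
suff: nx j a \in A by rewrite (negPf jA).
apply: (@turn_ind a (fun k => nx k a \in A) i) => // k ka kA.
have [_ ->] := turnP ka.
by have := none k; rewrite /enters ka kA andbT negbK.
Qed.

(** Two vertices that lie together on two different faces are consecutive on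
    each of them, as the faces share an edge. *)
Lemma common_edge i j a b : i != j -> a != b ->
    a \in M i -> b \in M i -> a \in M j -> b \in M j ->
  nx i a = b \/ pv i a = b.
Proof.
move=> neq_ij neq_ab ia ib ja jb.
have ca : a \in common M i j by rewrite !inE ia ja.
have cb : b \in common M i j by rewrite !inE ib jb.
case: (om_proper omM neq_ij) => [/card_le1_eqP/(_ _ _ ca cb) ab |].
  by rewrite ab eqxx in neq_ab.
case=> x ix [cE _]; move: ca cb; rewrite cE !inE.
case/orP=> /eqP a_x /orP[] /eqP b_x; rewrite a_x b_x ?eqxx // in neq_ab *.
  by left.
by right; rewrite nextK.
Qed.

Section Turning.
Variables S A B : {set V}.
Hypothesis cSAB : cut S A B.
Let color := cut_color cSAB.

Lemma cut_next i u : u \in M i -> u \in A -> nx i u \notin B.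
Proof. by move=> iu; apply: (cut_adj cSAB); apply: adj_next. Qed.

Lemma cut_prev i u : u \in M i -> u \in A -> pv i u \notin B.
Proof. by move=> iu; apply: (cut_adj cSAB); apply: adj_prev. Qed.

(** The other vertices of the face form a path that avoids S, hence they all
    lie on the side of the first one. *)
Lemma face_one_side i a : a \in M i ->
    (forall b, b \in S -> b \in M i -> b = a) -> nx i a \in A -> pv i a \in A.
Proof.
move=> ia Sa nA.
suff: pv i a \in a |: A.
  rewrite !inE => /predU1P[pv_a | //].
  by have := next_neq ia; rewrite -{1}pv_a prevK eqxx.
apply: (@cycle_ind _ (M i) (fun v => v \in a |: A) a) => //.
- exact: face_uniq.
- by rewrite !inE eqxx.
- move=> y iy; rewrite !inE => /predU1P[-> | Ay]; first by rewrite nA orbT.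
  have := color (nx i y); rewrite (negPf (cut_next iy Ay)).
  case: (boolP (nx i y \in S)) => [Sy _ | _].
    by rewrite (Sa _ Sy) ?eqxx // mem_next.
  by case: (_ \in A); rewrite ?orbT.
- by rewrite mem_prev.
Qed.
End Turning.

Definition changes (A B : {set V}) a i : nat :=
  leaves A a i + enters A a i + leaves B a i + enters B a i.

Lemma changes_le2 S A B a i : cut S A B -> changes A B a i <= 2.
Proof.
case=> color _ _ _; rewrite /changes /leaves /enters.
have := color (nx i a); have := color (pv i a).
by do !case: (_ \in _).
Qed.

Lemma changes_le1 S A B a i : cut S A B ->
  nx i a \in S \/ pv i a \in S -> changes A B a i <= 1.
Proof.
case=> color _ _ _ Sip; rewrite /changes /leaves /enters.
have := color (nx i a); have := color (pv i a).
by case: Sip => ->; do !case: (_ \in _).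
Qed.

Lemma changes_gt0 S A B a i : cut S A B -> a \in S -> 0 < changes A B a i ->
  a \in M i /\ exists2 b, b \in S :\ a & b \in M i.
Proof.
move=> cSAB Sa ch_i; have ia : a \in M i.
  by move: ch_i; rewrite /changes /leaves /enters; case: (a \in M i).
split=> //; apply/exists_inP; apply: contraT => /exists_inPn no_b.
have Si b : b \in S -> b \in M i -> b = a.
  move=> Sb ib; apply/eqP; apply: contraT => ba.
  by have := no_b b; rewrite !inE ba Sb ib => /(_ isT).
have sA := face_one_side cSAB ia Si.
have sB := face_one_side (cut_sym cSAB) ia Si.
have Sn : nx i a \notin S.
  apply/negP => Sn; have := next_neq ia.
  by rewrite (Si _ Sn) ?mem_next ?eqxx.
move: ch_i sA sB; rewrite /changes /leaves /enters.
have := cut_color cSAB (nx i a); have := cut_color cSAB (pv i a).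
rewrite (negPf Sn); case: (nx i a \in A); case: (nx i a \in B) => //.
  by move=> c1 _ ch_i /(_ isT) pA _; move: c1 ch_i; rewrite pA;
    do !case: (_ \in _).
by move=> c1 _ ch_i _ /(_ isT) pB; move: c1 ch_i; rewrite pB;
    do !case: (_ \in _).
Qed.

(** Another cut vertex b can be responsible for at most one passage from A to B
    or back, which counts twice since it leaves one side and enters the other.
    If a and b share a single face this is clear.  Otherwise the
    faces that they share are the two faces along the edge ab, and on
    each of them one neighbour of a is b itself, so that a single count
    is possible. *)
Lemma sum_changes_le2 S A B a b : cut S A B -> b \in S -> a != b ->
  \sum_(i | (a \in M i) && (b \in M i)) changes A B a i <= 2.
Proof.
move=> cSAB Sb ab; pose N := [pred i | (a \in M i) && (b \in M i)].
rewrite -/(\sum_(i | N i) _).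
have [edge_ab | ] := boolP [forall (i | N i), (nx i a == b) || (pv i a == b)].
  apply: (@leq_trans (\sum_(i | N i) 1)).
    apply: leq_sum => i Ni; apply: (changes_le1 cSAB).
    by have /orP[/eqP-> | /eqP->] := implyP (forallP edge_ab i) Ni;
      [left | right].
  rewrite sum1_card.
  pose E1 := [set i | (a \in M i) && (nx i a == b)].
  pose E2 := [set i | (b \in M i) && (nx i b == a)].
  have E1_le : #|E1| <= 1.
    apply/card_le1_eqP => i j.
    rewrite !inE => /andP[ia /eqP ni] /andP[ja /eqP nj].
    by apply: (om_coherent omM ja ia); rewrite ni.
  have E2_le : #|E2| <= 1.
    apply/card_le1_eqP => i j.
    rewrite !inE => /andP[ia /eqP ni] /andP[ja /eqP nj].
    by apply: (om_coherent omM ja ia); rewrite ni.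
  apply: (@leq_trans #|E1 :|: E2|); last first.
    by rewrite cardsU (leq_trans (leq_subr _ _)) // (leq_add E1_le E2_le).
  apply: subset_leq_card; apply/subsetP => i Ni; rewrite !inE.
  have /andP[-> ->] := Ni.
  have /orP[-> // | /eqP <-] := implyP (forallP edge_ab i) Ni.
  by rewrite prevK eqxx orbT.
case/forallPn => i; rewrite negb_imply => /andP[Ni not_edge].
rewrite (bigD1 i) //= big1 ?addn0; first exact: changes_le2 cSAB.
move=> j /andP[Nj ji]; case/negP: not_edge.
have /andP[ia ib] := Ni; have /andP[ja jb] := Nj.
rewrite eq_sym in ji.
by have [-> | ->] := common_edge ji ab ia ib ja jb; rewrite eqxx ?orbT.
Qed.

Lemma sum_changes_le S A B a : cut S A B -> a \in S ->
  \sum_i changes A B a i <= 2 * #|S|.-1.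
Proof.
move=> cSAB Sa; apply: (@leq_trans (\sum_(b in S :\ a) 2)); last first.
  rewrite sum_nat_const mulnC leq_mul2l /=.
  by have := cardsD1 a S; rewrite Sa; lia.
apply: (@leq_trans (\sum_(b in S :\ a)
    \sum_(i | (a \in M i) && (b \in M i)) changes A B a i)); last first.
  apply: leq_sum => b; rewrite !inE => /andP[ba Sb].
  by apply: (sum_changes_le2 cSAB); rewrite // eq_sym.
rewrite (exchange_big_dep predT) //=; apply: leq_sum => i _.
have [-> // | ] := posnP (changes A B a i).
case/(changes_gt0 cSAB Sa) => ia [b Sb ib].
by rewrite (bigD1 b) /= ?Sb ?ia ?ib // leq_addr.
Qed.

(** Every cut vertex has neighbours on both sides, as in a minimal cut. *)
Definition full_cut (S A B : {set V}) : Prop :=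
  cut S A B /\ forall a, a \in S ->
    (exists2 i, a \in M i & nx i a \in A) /\
    (exists2 i, a \in M i & nx i a \in B).

Lemma sum_changes_ge S A B a : full_cut S A B -> a \in S ->
  [/\ 0 < \sum_i leaves A a i, 0 < \sum_i enters A a i,
      0 < \sum_i leaves B a i & 0 < \sum_i enters B a i].
Proof.
case=> cSAB nb Sa; have [[i ia iA] [j ja jB]] := nb a Sa.
have color := cut_color cSAB.
have jA : nx j a \notin A.
  by have := color (nx j a); rewrite jB; do !case: (_ \in _).
have iB : nx i a \notin B.
  by have := color (nx i a); rewrite iA; do !case: (_ \in _).
have [[k1 e1] [k2 e2]] := leaves_enters_ex ia iA ja jA.
have [[k3 e3] [k4 e4]] := leaves_enters_ex ja jB ia iB.
by split; [rewrite (bigD1 k1) // e1 | rewrite (bigD1 k2) // e2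
         | rewrite (bigD1 k3) // e3 | rewrite (bigD1 k4) // e4].
Qed.

Lemma sum_changesE A B a : \sum_i changes A B a i =
  \sum_i leaves A a i + \sum_i enters A a i + \sum_i leaves B a i
    + \sum_i enters B a i.
Proof. by rewrite /changes !big_split. Qed.

(** Around a vertex of a minimal cut there are at least four counts (each side
    is left and entered), and at most two for each of the remaining cut
    vertices.  A cut that is not minimal is reduced by [cut_drop]. *)
Lemma cut_size_ge3 S A B : cut S A B -> 2 < #|S|.
Proof.
have [n] := ubnP #|S|; elim: n => // n IHn in S A B * => S_lt cSAB.
have S_gt0 := cut_nonempty cSAB.
have drop A' B' a : cut S A' B' -> a \in S ->
    ~ (exists2 i, a \in M i & nx i a \in A') -> 2 < #|S|.
  move=> cut' Sa no_nb; have := cardsD1 a S; rewrite Sa => S_a.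
  have noA i : a \in M i -> nx i a \notin A'.
    by move=> ia; apply/negP => Ai; apply: no_nb; exists i.
  by have := IHn _ _ _ _ (cut_drop cut' Sa noA); lia.
have [a Sa] := card_gt0P S_gt0.
have [full | not_full] := boolP [forall b in S,
    [exists i, (b \in M i) && (nx i b \in A)]
    && [exists i, (b \in M i) && (nx i b \in B)]].
  have fSAB : full_cut S A B.
    split=> // b Sb; have /andP[] := forall_inP full b Sb.
    by move=> /exists_inP ? /exists_inP.
  have [] := sum_changes_ge fSAB Sa.
  by have := sum_changes_le cSAB Sa; rewrite sum_changesE; lia.
have [b Sb] := forall_inPn not_full.
rewrite negb_and => /orP[] /exists_inP; first exact: drop cSAB Sb.
exact: drop (cut_sym cSAB) Sb.
Qed.

Lemma cut3_full S A B : cut S A B -> #|S| = 3 -> full_cut S A B.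
Proof.
move=> cSAB S3; split=> // a Sa.
have small : #|S :\ a| <= 2 by have := cardsD1 a S; rewrite Sa; lia.
have nb A' B' : cut S A' B' -> exists2 i, a \in M i & nx i a \in A'.
  move=> cut'; apply/exists_inP; apply: contraT => /exists_inPn noA.
  by have := cut_size_ge3 (cut_drop cut' Sa noA); lia.
by split; [apply: (nb A B) | apply: (nb B A); apply: cut_sym].
Qed.

(** With three cut vertices the two bounds on the number of counts agree, so
    that the neighbours of a in A form one interval around a. *)
Lemma cut3_crossing S A B a : cut S A B -> #|S| = 3 -> a \in S ->
  \sum_i leaves A a i = 1 /\ \sum_i enters A a i = 1.
Proof.
move=> cSAB S3 Sa; have [] := sum_changes_ge (cut3_full cSAB S3) Sa.
by have := sum_changes_le cSAB Sa; rewrite sum_changesE S3; lia.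
Qed.
End Map.

(** * Counting along one face *)

Lemma sum_bool1 (T : finType) (P : pred T) : \sum_x P x = 1 ->
  exists2 x, P x & forall y, P y -> y = x.
Proof.
move=> sumP; have [x Px | P0] := pickP P; last first.
  by rewrite big1 // in sumP => x _; rewrite P0.
exists x => // y Py; apply/eqP; apply: contraT => yx.
by move: sumP; rewrite (bigD1 x) //= (bigD1 y) //= Px Py.
Qed.

Section CutSide.
Variables (V I : finType) (M : I -> seq V) (S A B : {set V}).
Hypotheses (omM : oriented_map M) (cSAB : cut M S A B).

Local Notation nx i v := (next (M i) v).
Local Notation pv i v := (prev (M i) v).

Definition corner (A : {set V}) (a : V) (i : I) : bool :=
  [&& a \in M i, pv i a \in A & nx i a \in A].

Lemma cut_notA v : v \in S -> v \notin A.
Proof.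
by have := cut_color cSAB v; do !case: (v \in _).
Qed.

Lemma next_cutP i v : v \in M i -> v \in A -> nx i v \notin A -> nx i v \in S.
Proof.
move=> iv Av; have := cut_color cSAB (nx i v).
by have /negPf-> := cut_next cSAB iv Av; do !case: (_ \in _).
Qed.

Lemma cut_nextP i v : v \in M i -> v \notin A -> nx i v \in A -> v \in S.
Proof.
move=> iv Av An; have := cut_color cSAB v; rewrite (negPf Av).
have := cut_prev omM cSAB (_ : nx i v \in M i) An.
by rewrite mem_next (nextK omM) => /(_ iv)/negPf->; case: (v \in S).
Qed.

Lemma cut_prevP i v : v \in M i -> v \notin A -> pv i v \in A -> v \in S.
Proof.
move=> iv Av Ap; have := @next_cutP i (pv i v).
by rewrite mem_prev (prevK omM) => ->.
Qed.

Lemma sum_next i (F : V -> nat) :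
  \sum_(v | v \in M i) F (nx i v) = \sum_(v | v \in M i) F v.
Proof.
rewrite [RHS](reindex_inj (can_inj (nextK omM i))) /=.
by apply: eq_bigl => v; rewrite mem_next.
Qed.

Definition inside i : nat := \sum_(v | v \in M i) (v \in A).
Definition starts i : nat :=
  \sum_(v | v \in M i) ((v \notin A) && (nx i v \in A)).
Definition exits i : nat := \sum_(a in S) leaves M A a i.
Definition entries i : nat := \sum_(a in S) enters M A a i.
Definition corners i : nat := \sum_(a in S) corner A a i.

Lemma starts_entries i : starts i = entries i + corners i.
Proof.
rewrite /starts -big_split /= big_mkcond [RHS]big_mkcond /=.
apply: eq_bigr => v _.
rewrite /enters /corner; have [iv | niv] := boolP (v \in M i); last first.
  by rewrite !andFb; case: ifP.
have [Sv | nSv] := boolP (v \in S).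
  by rewrite (cut_notA Sv); case: (pv i v \in A);
    case: (nx i v \in A); case: (v \in A).
have [//|nAv] := boolP (v \in A); case: (boolP (_ \in A)) => // An.
by rewrite (cut_nextP iv nAv An) in nSv.
Qed.

Lemma starts_exits i : starts i = exits i + corners i.
Proof.
transitivity (\sum_(v | v \in M i) ((v \notin A) && (pv i v \in A))).
  pose both := \sum_(v | v \in M i) ((v \in A) && (nx i v \in A)).
  apply: (@addnI both); transitivity (inside i).
    rewrite /inside -(sum_next i (fun v => v \in A : nat)) -big_split /=.
    by apply: eq_bigr => v _; case: (pv i v \in A);
    case: (nx i v \in A); case: (v \in A).
  rewrite -(sum_next i (fun v => (v \notin A) && (pv i v \in A))) -big_split /=.
  by apply: eq_bigr => v _; rewrite (nextK omM); case: (pv i v \in A);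
    case: (nx i v \in A); case: (v \in A).
rewrite -big_split /= big_mkcond [RHS]big_mkcond /=; apply: eq_bigr => v _.
rewrite /leaves /corner; have [iv | niv] := boolP (v \in M i); last first.
  by rewrite !andFb; case: ifP.
have [Sv | nSv] := boolP (v \in S).
  by rewrite (cut_notA Sv); case: (pv i v \in A);
    case: (nx i v \in A); case: (v \in A).
have [//|nAv] := boolP (v \in A); case: (boolP (_ \in A)) => // Ap.
by rewrite (cut_prevP iv nAv Ap) in nSv.
Qed.

(** Walking once around a face, A is left as often as it is entered. *)
Lemma exits_entries i : exits i = entries i.
Proof. by have := starts_exits i; rewrite starts_entries; lia. Qed.

Lemma exits_gt0 i : (0 < exits i) = [exists a in S, leaves M A a i].
Proof.
apply/idP/exists_inP => [| [a Sa la]]; last by rewrite /exits (bigD1 a) //= la.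
rewrite lt0n sum_nat_eq0 => /forall_inPn[a Sa la]; exists a => //.
by move: la; case: (leaves _ _ _ _).
Qed.

Lemma entries_gt0 i : (0 < entries i) = [exists a in S, enters M A a i].
Proof.
apply/idP/exists_inP => [| [a Sa la]]; last by rewrite /entries (bigD1 a) //= la.
rewrite lt0n sum_nat_eq0 => /forall_inPn[a Sa la]; exists a => //.
by move: la; case: (enters _ _ _ _).
Qed.

(** A cut vertex cannot be both an exit and an entry of the same face, and there
    are as many exits as entries among three vertices. *)
Lemma exits_le1 i : #|S| = 3 -> exits i <= 1.
Proof.
move=> S3; suff: exits i + entries i <= 3 by rewrite -exits_entries; lia.
rewrite -S3 -sum1_card -big_split /=; apply: leq_sum => a _.
by rewrite /leaves /enters; do !case: (_ \in _).
Qed.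

(** On a face that meets A and has no exit, cut vertices occur only one at a
    time, between two vertices of A. *)
Lemma face_no_exit i u : exits i = 0 -> u \in M i -> u \in A ->
  forall v, v \in M i -> (v \in A) || (nx i v \in A).
Proof.
move=> ex0 iu Au; apply: (@cycle_ind _ (M i) _ u) => //.
- exact: face_uniq omM i.
- by rewrite Au.
move=> v iv /orP[Av | -> //]; have [// | An /=] := boolP (nx i v \in A).
have Sn := next_cutP iv Av An.
have /existsPn/(_ (nx i v)) : ~~ [exists a in S, leaves M A a i].
  by rewrite -exits_gt0 ex0.
by rewrite Sn /leaves mem_next iv (nextK omM) Av negbK.
Qed.

(** The face lies on the side of A: by [face_no_exit], each of its edges
    meets A. *)
Definition full i : bool := (0 < inside i) && (exits i == 0).

Lemma inside_gt0 i : (0 < inside i) = [exists v, (v \in M i) && (v \in A)].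
Proof.
apply/idP/existsP => [| [v /andP[iv Av]]]; last by rewrite /inside (bigD1 v) //= Av.
rewrite lt0n sum_nat_eq0 => /forall_inPn[v iv Av]; exists v.
by rewrite iv; move: Av; case: (v \in A).
Qed.

Lemma full_inside i : full i -> inside i + starts i = size (M i).
Proof.
case/andP; rewrite inside_gt0 => /existsP[u /andP[iu Au]] /eqP ex0.
rewrite -big_split /= -(card_uniqP (face_uniq omM i)) -sum1_card.
apply: eq_bigr => v iv; have := face_no_exit ex0 iu Au iv.
by case: (pv i v \in A);
    case: (nx i v \in A); case: (v \in A).
Qed.

(** * The embedded graph of the edges that meet one side *)

Hypothesis S3 : #|S| = 3.

Lemma leaves_unique a : a \in S ->
  exists2 i, leaves M A a i & forall j, leaves M A a j -> j = i.
Proof. by case/(cut3_crossing omM cSAB S3) => /sum_bool1. Qed.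

Lemma enters_unique a : a \in S ->
  exists2 i, enters M A a i & forall j, enters M A a j -> j = i.
Proof. by case/(cut3_crossing omM cSAB S3) => _ /sum_bool1. Qed.

Definition exit_face a i : I := odflt i [pick j | leaves M A a j].
Definition entry_face a i : I := odflt i [pick j | enters M A a j].

Lemma exit_faceP a i : a \in S -> leaves M A a (exit_face a i).
Proof.
case/leaves_unique=> j lj _; rewrite /exit_face.
by case: pickP => [// | /(_ j)]; rewrite lj.
Qed.

Lemma entry_faceP a i : a \in S -> enters M A a (entry_face a i).
Proof.
case/enters_unique=> j lj _; rewrite /entry_face.
by case: pickP => [// | /(_ j)]; rewrite lj.
Qed.

Lemma exit_face_eq a i j : a \in S -> leaves M A a j -> exit_face a i = j.
Proof.
move=> Sa lj; case: (leaves_unique Sa) => k _ uk.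
by rewrite (uk j) // (uk _ (exit_faceP i Sa)).
Qed.

Lemma entry_face_eq a i j : a \in S -> enters M A a j -> entry_face a i = j.
Proof.
move=> Sa lj; case: (enters_unique Sa) => k _ uk.
by rewrite (uk j) // (uk _ (entry_faceP i Sa)).
Qed.

(** A dart is a pair of a face and a vertex v on it; it stands for the edge from
    v to its successor on the face, which has the face on its left. *)
Definition darts : {set V * I} :=
  [set d | (d.1 \in M d.2) && ((d.1 \in A) || (nx d.2 d.1 \in A))].

Definition opposite (d : V * I) : V * I :=
  (nx d.2 d.1, turn M (nx d.2 d.1) d.2).

(** Rotation around a vertex within the retained darts.  At a cut vertex these
    form one interval, which is closed up into a cycle by jumping from its
    last dart, on the entry face, to the first one, next to the exit face. *)
Definition around (d : V * I) : V * I :=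
  if (d.1 \in S) && enters M A d.1 d.2
  then (d.1, turn M d.1 (exit_face d.1 d.2)) else (d.1, turn M d.1 d.2).

(** Walking along the faces of the embedded graph.  When the face of M leaves A
    at the cut vertex w, the walk goes on along the face that enters A at w. *)
Definition along (d : V * I) : V * I :=
  let w := nx d.2 d.1 in
  if (w, d.2) \in darts then (w, d.2) else (w, entry_face w d.2).

Lemma dartE v i :
  ((v, i) \in darts) = (v \in M i) && ((v \in A) || (nx i v \in A)).
Proof. by rewrite inE. Qed.

Lemma along_leaves v i : (v, i) \in darts -> (nx i v, i) \notin darts ->
  nx i v \in S /\ leaves M A (nx i v) i.
Proof.
rewrite !dartE mem_next => /andP[iv]; rewrite iv /= negb_or.
case/orP=> [Av | An] /andP[nAn nAnn]; last by rewrite An in nAn.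
split; first exact: next_cutP Av nAn.
by rewrite /leaves mem_next iv (nextK omM) Av.
Qed.

Lemma entry_dart a i : a \in S -> (a, entry_face a i) \in darts.
Proof.
by move=> Sa; have /and3P[ia _ An] := entry_faceP i Sa; rewrite dartE ia An orbT.
Qed.

Lemma turn_dart v i : v \in M i -> (v \in A) || (pv i v \in A) ->
  (v, turn M v i) \in darts.
Proof. by move=> iv; rewrite dartE; have [-> ->] := turnP omM iv. Qed.

Lemma opposite_dart d : d \in darts -> opposite d \in darts.
Proof.
case: d => v i; rewrite dartE /= => /andP[iv vA]; apply: turn_dart => /=.
  by rewrite mem_next.
by rewrite (nextK omM) orbC.
Qed.

Lemma around_dart d : d \in darts -> around d \in darts.
Proof.
case: d => v i; rewrite dartE /around /= => /andP[iv vA].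
case: ifP => [/andP[Sv _] | /negbT not_enter].
  have /and3P[ev Ap _] := exit_faceP i Sv.
  by apply: turn_dart; rewrite // Ap orbT.
apply: turn_dart => //; case/orP: vA => [-> // | An].
have [//|nAv] := boolP (v \in A); move: not_enter.
by rewrite (cut_nextP iv nAv An) /enters iv An andbT negbK => ->.
Qed.

Lemma along_dart d : d \in darts -> along d \in darts.
Proof.
case: d => v i dvi; rewrite /along /=; case: ifP => // /negbT nd.
by have [Sn _] := along_leaves dvi nd; apply: entry_dart.
Qed.

Lemma oppositeK d : d \in darts -> opposite (opposite d) = d.
Proof.
case: d => v i; rewrite dartE /opposite /= => /andP[iv _].
have in_v : nx i v \in M i by rewrite mem_next.
have [tv _] := turnP omM in_v.
have tn : nx (turn M (nx i v) i) (nx i v) = v.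
  by have [_ ->] := turnP omM in_v; rewrite (nextK omM).
have tv' : v \in M (turn M (nx i v) i).
  by have := mem_next (M (turn M (nx i v) i)) (nx i v); rewrite tn tv.
have pt : pv (turn M (nx i v) i) v = nx i v.
  by have := nextK omM (turn M (nx i v) i) (nx i v); rewrite tn.
by rewrite tn; congr (_, _); apply: (turn_eq omM).
Qed.

Lemma opposite_neq d : d \in darts -> opposite d != d.
Proof.
case: d => v i; rewrite dartE => /andP[iv _].
by apply/eqP => -[nv _]; have := next_neq omM iv; rewrite nv eqxx.
Qed.

Lemma around_along d : d \in darts -> around (along d) = opposite d.
Proof.
case: d => v i dvi; rewrite /along /=; case: ifP => [din | /negbT nd].
  rewrite /around /opposite /=; case: ifP => // /andP[Sn /and3P[_ nAp An]].
  move: dvi; rewrite dartE (negPf (cut_notA Sn)) orbF => /andP[_ Av].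
  by rewrite (nextK omM) Av in nAp.
have [Sn lv] := along_leaves dvi nd.
rewrite /around /opposite /= Sn entry_faceP //=.
by rewrite (exit_face_eq _ Sn lv).
Qed.

(** At a cut vertex every orbit of [around] runs through the entry face: one
    that does not would be a full turn around the vertex. *)
Lemma around_labels : orbit_labels darts around fst.
Proof.
split=> [[v i] _ | [v i] [w j]]; first by rewrite /around /=; case: ifP.
rewrite !dartE /= => /andP[iv _] + vw; rewrite -{w}vw => /andP[jv _].
have [Sv | nSv] := boolP (v \in S); last first.
  exists (v, j) => //.
  apply: (@turn_ind _ _ _ omM v (fun k => fconnect around (v, i) (v, k)) i) => //.
  move=> k kv; move/connect_trans; apply; apply: connect1.
  by rewrite /= /around /= (negPf nSv).
have to_entry k : v \in M k -> fconnect around (v, k) (v, entry_face v i).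
  move=> kv; apply: contraT => no_conn.
  suff conn l : v \in M l -> fconnect around (v, k) (v, l).
    by have /and3P[ev _ _] := entry_faceP i Sv; rewrite conn in no_conn.
  apply: (@turn_ind _ _ _ omM v (fun l => fconnect around (v, k) (v, l)) k) => //.
  move=> {}l lv kl; apply: connect_trans (kl) _; apply: connect1.
  rewrite /= /around /= Sv /=; case: ifP => // /(entry_face_eq i Sv) el.
  by rewrite el kl in no_conn.
by exists (v, entry_face v i); apply: to_entry.
Qed.

(** A walk that starts on a face with an exit cannot stay on it, since the face
    has an edge that does not meet A; so it passes to an entry face. *)
Lemma special_reaches v i : (v, i) \in darts -> 0 < exits i ->
  exists2 a, a \in S & forall k, fconnect along (v, i) (a, entry_face a k).
Proof.
move=> dvi; rewrite exits_gt0 => /exists_inP[b Sb /and3P[ib _ nAnb]].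
have [/exists_inP[a Sa conn] | /exists_inPn none] :=
  boolP [exists a in S, fconnect along (v, i) (a, entry_face a i)].
  by exists a => // k; rewrite (entry_face_eq k Sa (entry_faceP i Sa)).
have iv : v \in M i by move: dvi; rewrite dartE => /andP[].
suff: (b, i) \in darts.
  by rewrite dartE (negPf nAnb) orbF (negPf (cut_notA Sb)) andbF.
suff all_u u : u \in M i -> (u, i) \in darts /\ fconnect along (v, i) (u, i).
  by case: (all_u b ib).
apply: (@cycle_ind _ (M i) (fun u => _ /\ _) v) => //.
  exact: face_uniq omM i.
move=> {}u iu [du cu].
have step : fconnect along (v, i) (along (u, i)).
  exact: connect_trans cu (fconnect1 _ _).
have [dn | nd] := boolP ((nx i u, i) \in darts).
  by rewrite /along /= dn in step.
have [Sn _] := along_leaves du nd.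
by have := none _ Sn; rewrite /along /= (negPf nd) in step; rewrite step.
Qed.

(** The walk that enters A at a leaves it at another cut vertex: no face enters
    and leaves A at the same vertex. *)
Lemma entry_reaches a i : a \in S -> exists2 b, b \in S & b != a /\
  fconnect along (a, entry_face a i) (b, entry_face b i).
Proof.
move=> Sa; set j := entry_face a i.
have enter_j : enters M A a j := entry_faceP i Sa.
have /and3P[ja nAp An] := enter_j.
have [/exists_inP[b Sb /andP[ba conn]] | /exists_inPn none] :=
  boolP [exists b in S, (b != a) && fconnect along (a, j) (b, entry_face b i)].
  by exists b.
suff: (pv j a, j) \in darts.
  by rewrite dartE (negPf nAp) (prevK omM) (negPf (cut_notA Sa)) andbF.
suff all_u u : u \in M j -> (u, j) \in darts /\ fconnect along (a, j) (u, j).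
  by case: (all_u (pv j a)); rewrite ?mem_prev.
apply: (@cycle_ind _ (M j) (fun u => _ /\ _) a) => //.
- exact: face_uniq omM j.
- by split=> //; apply: entry_dart.
move=> {}u ju [du cu].
have step : fconnect along (a, j) (along (u, j)).
  exact: connect_trans cu (fconnect1 _ _).
have [dn | nd] := boolP ((nx j u, j) \in darts).
  by rewrite /along /= dn in step.
have [Sn lj] := along_leaves du nd.
have na : nx j u != a.
  apply/eqP => na; move: lj enter_j; rewrite na /leaves /enters.
  by case/and3P=> _ ->; rewrite andbF.
have := none _ Sn; rewrite /along /= (negPf nd) in step.
by rewrite na (entry_face_eq i Sn (entry_faceP j Sn)) step.
Qed.

(** A map without fixed points on three points has one connected component;
    this is why the faces with exits merge into one boundary component. *)
Lemma entries_meet a b i : a \in S -> b \in S -> exists2 z,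
  fconnect along (a, entry_face a i) z & fconnect along (b, entry_face b i) z.
Proof.
move=> Sa Sb; have [->|ab] := eqVneq a b; first by exists (b, entry_face b i).
have [a' Sa' [a'a aa']] := entry_reaches i Sa.
have [b' Sb' [b'b bb']] := entry_reaches i Sb.
have [a'b | a'b] := eqVneq a' b; first by exists (b, entry_face b i); rewrite -?a'b.
have [b'a | b'a] := eqVneq b' a; first by exists (a, entry_face a i); rewrite -?b'a.
suff a'_b' : a' = b' by rewrite a'_b' in aa'; exists (b', entry_face b' i).
apply/eqP; apply: contraT => a'b'.
have : #|b' |: (a' |: [set a; b])| <= #|S|.
  by apply/subset_leq_card/subsetP => x; rewrite !inE => /or4P[] /eqP->.
rewrite eq_sym in a'b'.
by rewrite !cardsU1 cards1 !inE !negb_or ab a'b a'a b'b b'a a'b' S3.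
Qed.

(** All the faces with exits get the same label. *)
Definition along_label (d : V * I) : option I :=
  if 0 < exits d.2 then None else Some d.2.

Lemma along_labels : orbit_labels darts along along_label.
Proof.
split=> [[v i] dvi | [v i] [w j] dvi dwj].
  have [dn | nd] := boolP ((nx i v, i) \in darts).
    by rewrite /along /= dn.
  rewrite /along /along_label /= (negPf nd) /=.
  have [Sn lv] := along_leaves dvi nd.
  have -> : 0 < exits i by rewrite exits_gt0; apply/exists_inP; exists (nx i v).
  suff -> : 0 < exits (entry_face (nx i v) i) by [].
  rewrite exits_entries entries_gt0; apply/exists_inP; exists (nx i v) => //.
  exact: entry_faceP.
rewrite /along_label /=; have [ex_i | ex_i] := ifP;
  have [ex_j | ex_j //] := ifP => //.
  move=> _; have [a Sa va] := special_reaches dvi ex_i.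
  have [b Sb wb] := special_reaches dwj ex_j.
  have [z az bz] := entries_meet i Sa Sb.
  by exists z; [exact: connect_trans (va i) az | exact: connect_trans (wb i) bz].
case=> ij; rewrite -{j ex_j}ij in dwj *; exists (w, i) => //.
have [iv iw] : v \in M i /\ w \in M i.
  by move: dvi dwj; rewrite !dartE => /andP[-> _] /andP[-> _].
suff all_u u : u \in M i -> (u, i) \in darts /\ fconnect along (v, i) (u, i).
  by case: (all_u w iw).
apply: (@cycle_ind _ (M i) (fun u => _ /\ _) v) => //.
  exact: face_uniq omM i.
move=> {}u iu [du cu].
have step : fconnect along (v, i) (along (u, i)).
  exact: connect_trans cu (fconnect1 _ _).
have [dn | nd] := boolP ((nx i u, i) \in darts).
  by rewrite /along /= dn in step.
have [Sn lu] := along_leaves du nd.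
by move: ex_i; rewrite exits_gt0 => /existsP[]; exists (nx i u); rewrite Sn.
Qed.

Lemma card_around_labels : #|fst @: darts| = #|A| + 3.
Proof.
have -> : #|A| + 3 = #|S :|: A|.
  rewrite cardsU (_ : S :&: A = set0) ?cards0 ?subn0 ?S3 1?addnC //.
  by apply/setP => v; rewrite !inE; apply/andP => -[/cut_notA/negPf->].
apply: eq_card => v; rewrite inE; apply/imsetP/orP => [[[w i] + ->] | [Sv | Av]].
- rewrite dartE /= => /andP[iw wA].
  have [|nAw] := boolP (w \in A); [by right | left].
  by rewrite (negPf nAw) in wA; apply: cut_nextP iw nAw wA.
- have [i /and3P[iv _ An] _] := enters_unique Sv.
  by exists (v, i); rewrite ?dartE ?iv ?An ?orbT.
- by have [i iv] := face_ex omM v; exists (v, i); rewrite ?dartE ?iv ?Av.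
Qed.

Lemma card_along_labels : #|along_label @: darts| = (\sum_i full i).+1.
Proof.
have -> : along_label @: darts = None |: (Some @: [set i | full i]).
  apply/setP => z; rewrite !inE; apply/imsetP/orP => [[[v i] + ->] | ].
    rewrite dartE /along_label /= => /andP[iv vA].
    have [ | ex0] := posnP (exits i); last by left.
    move=> ex0; right; apply: imset_f; rewrite inE /full ex0 eqxx andbT.
    rewrite inside_gt0; apply/existsP.
    by case/orP: vA => [Av|An]; [exists v | exists (nx i v)]; rewrite ?mem_next iv.
  case=> [/eqP-> | /imsetP[i + ->]].
    have [a Sa] : exists a, a \in S by apply/card_gt0P; rewrite S3.
    have [i ei _] := enters_unique Sa.
    exists (a, i).
      by case/and3P: ei => ia _ An; rewrite dartE ia An orbT.
    rewrite /along_label /= exits_entries entries_gt0.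
    by case: existsP => // -[]; exists a; rewrite Sa.
  rewrite inE => /andP[]; rewrite inside_gt0 => /existsP[v /andP[iv Av]] /eqP ex0.
  by exists (v, i); rewrite ?dartE ?iv ?Av // /along_label /= ex0.
rewrite cardsU1 card_imset; last exact: Some_inj.
rewrite (_ : None \notin _) ?add1n; last by apply/imsetP => -[].
by rewrite -sum1dep_card big_mkcond; congr _.+1; apply: eq_bigr => i _; case: full.
Qed.

Lemma card_darts : #|darts| = \sum_i (inside i + starts i).
Proof.
transitivity (\sum_v \sum_i ((v, i) \in darts)).
  rewrite pair_bigA /= -sum1_card big_mkcond.
  by apply: eq_bigr => -[v i] _ /=; case: ifP.
rewrite exchange_big /=; apply: eq_bigr => i _.
rewrite -big_split /= [RHS]big_mkcond /=; apply: eq_bigr => v _.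
by rewrite dartE; case: (v \in M i); case: (v \in A); case: (_ \in A).
Qed.

(** The sum is the number of darts, hence twice the number e of edges that
    meet A.  The three cut vertices and the one boundary component formed by the
    faces with exits together contribute an even number. *)
Lemma cut_side_parity :
  exists e, \sum_i (inside i + starts i) = e.*2
         /\ ~~ odd (#|A| + e + \sum_i full i).
Proof.
have [] := orbit_count_parity _ _ around_labels along_labels (a := opposite).
- by move=> d dd; rewrite around_dart // along_dart // opposite_dart.
- by move=> d dd; rewrite oppositeK // opposite_neq // around_along.
move=> e []; rewrite card_darts card_around_labels card_along_labels => De odd_e.
by exists e; split=> //; move: odd_e; lia.
Qed.

End CutSide.

(** * Curvature *)

Local Open Scope ring_scope.

Section FlatMaps.
Variables (V I : finType) (M : I -> seq V).
Hypothesis omM : oriented_map M.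

Local Notation nx i v := (next (M i) v).
Local Notation pv i v := (prev (M i) v).

(** The name recalls that a regular p-gon has the angle 1/2 - 1/p, in turns: the
    angle falls short of a straight one by the width 1/p. *)
Definition face_width i : rat := (size (M i))%:R^-1.

Lemma size_width i : (size (M i))%:R * face_width i = 1.
Proof. by rewrite divff // pnatr_eq0 -lt0n; apply: leq_trans (face_size omM i). Qed.

Lemma width_gt0 i : 0 < face_width i.
Proof. by rewrite invr_gt0 ltr0n; apply: leq_trans (face_size omM i). Qed.

Lemma width_le i : face_width i <= 1 / 3.
Proof.
rewrite /face_width div1r lef_pV2 ?posrE ?ltr0n ?ler_nat ?(face_size omM) //.
by apply: leq_trans (face_size omM i).
Qed.

(** Regular polygons of the sizes of the faces fit around every vertex. *)
Definition flat : Prop :=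
  forall v, \sum_(i | v \in M i) (1 / 2 - face_width i) = 1.

Definition wide : Prop := forall v i j, v \in M i -> v \in M j -> i != j ->
  1 / 3 <= face_width i + face_width j.

(** The angles at the vertices of C, summed face by face. *)
Lemma sum_angles (C : {set V}) : flat ->
  \sum_i (inside M C i)%:R * (1 / 2 - face_width i) = #|C|%:R.
Proof.
move=> flatM; rewrite -sum1_card natr_sum.
transitivity (\sum_(v in C) \sum_(i | v \in M i) (1 / 2 - face_width i)); last first.
  by apply: eq_bigr => v _; rewrite flatM.
rewrite (exchange_big_dep predT) //=; apply: eq_bigr => i _.
rewrite /inside natr_sum mulr_suml big_mkcond [RHS]big_mkcond /=.
by apply: eq_bigr => v _; case: (v \in M i); case: (v \in C); rewrite ?mul1r ?mul0r.
Qed.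

Lemma starts_outside (A : {set V}) i : inside M A i = 0%N -> starts M A i = 0%N.
Proof.
move=> A0; apply/eqP; rewrite sum_nat_eq0; apply/forall_inP => v iv.
rewrite eqb0 negb_and; apply/orP; right; apply/negP => An.
suff : (0 < inside M A i)%N by rewrite A0.
by rewrite inside_gt0; apply/existsP; exists (nx i v); rewrite mem_next iv.
Qed.

(** The contribution of a face to e - |A| - f, where e counts the edges with an
    end in A and f the faces on the side of A.  The face gives half an edge for
    each of its edges meeting A, of which there are [inside] + [starts], and,
    by flatness, one angle 1/2 - 1/p to the vertex count for each of its
    vertices in A. *)
Definition excess (S A : {set V}) i : rat :=
  (starts M A i)%:R / 2 + (inside M A i)%:R * face_width i - (full M S A i)%:R.

Section Cut.
Variables S A B : {set V}.
Hypothesis cSAB : cut M S A B.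

Let cSBA := cut_sym cSAB.

(** The edges of the face that join two cut vertices. *)
Definition borders i : nat :=
  \sum_(v | v \in M i) ((v \in S) && (nx i v \in S)).

Lemma inside_total i :
  (inside M A i + inside M B i + inside M S i)%N = size (M i).
Proof.
rewrite -!big_split -(card_uniqP (face_uniq omM i)) -sum1_card /=.
by apply: eq_bigr => v _; have := cut_color cSAB v; lia.
Qed.

Lemma starts_total i :
  (starts M A i + starts M B i + borders i)%N = inside M S i.
Proof.
rewrite -!big_split /=; apply: eq_bigr => v iv.
have := cut_color cSAB v; have := cut_color cSAB (nx i v).
have : ~~ ((v \in A) && (nx i v \in B)).
  by apply/negP => /andP[/(cut_next cSAB iv)/negPf->].
have : ~~ ((v \in B) && (nx i v \in A)).
  by apply/negP => /andP[/(cut_next cSBA iv)/negPf->].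
case: (v \in A); case: (v \in B); case: (v \in S) => //;
by case: (nx i v \in A); case: (nx i v \in B); case: (nx i v \in S).
Qed.

Lemma border_ge i a : a \in S -> a \in M i -> nx i a \in S -> (0 < borders i)%N.
Proof. by move=> Sa ia Sn; rewrite /borders (bigD1 a) //= Sa Sn. Qed.

(** A face on neither side is cut by the curve.  It meets A or B, unless all
    of its edges join cut vertices; if it meets both sides it leaves both, and
    if it meets only one side, it leaves that side along an edge that joins cut
    vertices. *)
Lemma face_crossings i : (2 <= 2 * full M S A i + 2 * full M S B i
  + (exits M S A i + exits M S B i) + borders i)%N.
Proof.
rewrite /full.
have exit_border A' B' : cut M S A' B' -> inside M B' i = 0%N ->
    (0 < exits M S A' i -> 0 < borders i)%N.
  move=> cut' B0; rewrite exits_gt0 => /exists_inP[a Sa /and3P[ia _ nAn]].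
  apply: (border_ge Sa ia); have := cut_color cut' (nx i a).
  suff /negPf-> : nx i a \notin B' by rewrite (negPf nAn); case: (_ \in S).
  apply/negP => Bn; suff : (0 < inside M B' i)%N by rewrite B0.
  by rewrite inside_gt0; apply/existsP; exists (nx i a); rewrite mem_next ia.
have bA := exit_border _ _ cSAB; have bB := exit_border _ _ cSBA.
have := inside_total i; have := starts_total i; have := face_size omM i.
have := starts_exits omM cSAB i; have := starts_exits omM cSBA i.
have sA0 := @starts_outside A i; have sB0 := @starts_outside B i.
move: bA bB sA0 sB0.
move: (inside M A i) (inside M B i) (exits M S A i) (exits M S B i).
by move=> [|a] [|b] [|x] [|y] /=; lia.
Qed.

(** Summed over the faces, the right hand side is 3 + 3: the full angles at the
    three cut vertices, and half of the three exits of each side. *)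
Lemma excess_pair_le i : excess S A i + excess S B i <=
  (inside M S i)%:R * (1 / 2 - face_width i)
    + ((exits M S A i)%:R + (exits M S B i)%:R) / 2.
Proof.
have := face_crossings i; rewrite -(ler_nat rat) !natrD => crossings.
have := size_width i; rewrite -inside_total !natrD !mulrDl => widths.
have /(congr1 (fun n => n%:R : rat)) := starts_total i; rewrite !natrD => starts_i.
by rewrite /excess; lra.
Qed.

Hypotheses (S3 : #|S| = 3) (flatM : flat).

Lemma excess_parity : exists n m : nat,
  \sum_i excess S A i = n%:R - m%:R /\ ~~ odd (n + m).
Proof.
have [e [De odd_e]] := cut_side_parity omM cSAB S3.
exists e, (#|A| + \sum_i full M S A i)%N; split; last by lia.
rewrite natrD -(sum_angles A flatM) natr_sum.
have : (e.*2)%:R = 2 * e%:R :> rat by rewrite -muln2 natrM mulrC.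
rewrite -De natr_sum => e2.
have -> : e%:R = \sum_i ((inside M A i + starts M A i)%:R / 2) :> rat.
  by rewrite -mulr_suml e2 mulrC mulKf.
rewrite opprD addrA -!sumrB; apply: eq_bigr => i _.
by rewrite /excess natrD; lra.
Qed.

Lemma sum_exits (F : I -> rat) :
  \sum_i (exits M S A i)%:R * F i =
  \sum_(a in S) \sum_i (leaves M A a i)%:R * F i.
Proof.
rewrite exchange_big; apply: eq_bigr => i _.
by rewrite /exits natr_sum mulr_suml.
Qed.

Lemma sum_entries (F : I -> rat) :
  \sum_i (entries M S A i)%:R * F i =
  \sum_(a in S) \sum_i (enters M A a i)%:R * F i.
Proof.
rewrite exchange_big; apply: eq_bigr => i _.
by rewrite /entries natr_sum mulr_suml.
Qed.

Lemma sum_unique (P : pred I) (F : I -> rat) i :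
  P i -> (forall j, P j -> j = i) -> \sum_j (P j)%:R * F j = F i.
Proof.
move=> Pi Pu; rewrite (bigD1 i) //= Pi mul1r big1 ?addr0 // => j /negPf ji.
by case: (boolP (P j)) => [/Pu/eqP | _]; rewrite ?ji // mul0r.
Qed.

Lemma sum_exits1 : \sum_i (exits M S A i)%:R = 3%:R :> rat.
Proof.
rewrite -(eq_bigr _ (fun i _ => mulr1 _)) sum_exits.
have -> : 3%:R = #|S|%:R :> rat by rewrite S3.
rewrite -sum1_card natr_sum.
apply: eq_bigr => a Sa; have [i li ui] := leaves_unique omM cSAB S3 Sa.
by rewrite (sum_unique _ li).
Qed.

Hypothesis wideM : wide.

(** Every face has as many exits as entries, so that the sum is half of the sum,
    over the cut vertices, of the widths of the exit face and the entry face,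
    which are at least 1/3 together. *)
Lemma sum_exit_widths : 1 / 2 <= \sum_i (exits M S A i)%:R * face_width i.
Proof.
(* Each exit is counted once as such and once as an entry of the same face. *)
suff : 1 <= \sum_i (exits M S A i)%:R * face_width i
           + \sum_i (entries M S A i)%:R * face_width i.
  rewrite [X in _ <= _ + X](eq_bigr (fun i => (exits M S A i)%:R * face_width i)).
    lra.
  by move=> i _; rewrite (exits_entries omM cSAB).
rewrite sum_exits sum_entries -big_split /=.
rewrite [leLHS](_ : _ = \sum_(a in S) 1 / 3); last first.
  by rewrite sumr_const S3 -mulr_natr; lra.
apply: ler_sum => a Sa.
have [i li ui] := leaves_unique omM cSAB S3 Sa.
have [j ej uj] := enters_unique omM cSAB S3 Sa.
rewrite (sum_unique _ li) // (sum_unique _ ej) //.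
have /and3P[ia ip _] := li; have /and3P[ja jp _] := ej.
by apply: (wideM ia ja); apply: contraNneq jp => <-.
Qed.

Lemma exits_inside i : (exits M S A i <= inside M A i)%N.
Proof.
have [-> // | ex_gt0] := posnP (exits M S A i).
apply: leq_trans (exits_le1 omM cSAB i S3) _.
move: ex_gt0; rewrite exits_gt0 => /exists_inP[a _ /and3P[ia Ap _]].
by rewrite inside_gt0; apply/existsP; exists (pv i a); rewrite mem_prev ia.
Qed.

(** A face on the side of A has excess equal to the sum of its angles at cut
    vertices, each of which is at least 1/6.  For a face with an exit the excess
    is at least 1/2, plus the width for each of its vertices in A; the term with
    the predecessor counts these vertices beyond the first. *)
Lemma excess_ge i : (exits M S A i)%:R * (1 / 2 + face_width i)
    + (exits M S A i * (inside M A i).-1)%:R * face_width i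
    + (corners M S A i)%:R * (1 / 6) <= excess S A i.
Proof.
have ex1 := exits_le1 omM cSAB i S3; have exin := exits_inside i.
have st := starts_exits omM cSAB i.
have w0 := width_gt0 i; have w3 := width_le i.
have c0 := ler0n rat (corners M S A i).
have [f_i | nf_i] := boolP (full M S A i).
  have /andP[_ /eqP ex0] := f_i.
  have := size_width i; rewrite -(full_inside omM cSAB f_i) natrD mulrDl.
  rewrite /excess f_i st ex0.
  have := mulr_ge0 c0 (_ : 0 <= 1 / 3 - face_width i); rewrite subr_ge0 => /(_ w3).
  rewrite add0n mul0n /=; lra.
have [A0 | A_gt0] := posnP (inside M A i).
  have s0 := starts_outside A0.
  have -> : exits M S A i = 0%N by lia.
  have -> : corners M S A i = 0%N by lia.
  by rewrite /excess s0 A0 (negPf nf_i) mul0n /=; lra.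
have ex_i : exits M S A i = 1%N.
  by move: nf_i; rewrite /full A_gt0 /=; lia.
have in_eq : (inside M A i)%:R = 1 + (inside M A i).-1%:R :> rat.
  by rewrite nat1r prednK.
rewrite /excess st ex_i (negPf nf_i) mul1n in_eq natrD /=; lra.
Qed.

(** A lower bound for what the excess loses by keeping one vertex of A on each
    face with an exit, and by dropping the angles at cut vertices between two
    neighbours in A. *)
Definition slack i : rat :=
  (exits M S A i * (inside M A i).-1)%:R * face_width i
    + (corners M S A i)%:R * (1 / 6).

Lemma slack_ge0 i : 0 <= slack i.
Proof. by rewrite addr_ge0 ?mulr_ge0 ?ler0n // ltW // width_gt0. Qed.

Lemma excess_sum_ge : 2 + \sum_i slack i <= \sum_i excess S A i.
Proof.
apply: (@le_trans _ _ (\sum_i ((exits M S A i)%:R * (1 / 2)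
  + (exits M S A i)%:R * face_width i + slack i))); last first.
  by apply: ler_sum => i _; have := excess_ge i; rewrite /slack; lra.
have half : \sum_i (exits M S A i)%:R * (1 / 2) = 3 / 2 :> rat.
  by rewrite -mulr_suml sum_exits1; lra.
have := sum_exit_widths; rewrite !big_split /= half; lra.
Qed.

Lemma excess_sum_cases :
  \sum_i excess S A i = 2 \/ 4 <= \sum_i excess S A i.
Proof.
have ge2 : 2 <= \sum_i excess S A i.
  apply: le_trans excess_sum_ge; rewrite lerDl; apply: sumr_ge0 => i _.
  exact: slack_ge0.
have [n [m [exE odd_nm]]] := excess_parity; rewrite exE in ge2 *.
have nm : (m + 2 <= n)%N by rewrite -(ler_nat rat) natrD; lra.
have [->|] : (n = m + 2 \/ m + 4 <= n)%N by lia.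
  by left; rewrite natrD; lra.
by rewrite -(ler_nat rat) natrD; right; lra.
Qed.

(** Equality forces all slacks to vanish.  Then no face passes through a cut
    vertex a between two neighbours of a in A, so a has one
    neighbour x in A, which lies on both the exit and the entry face of a; and
    x is the only vertex of A on these faces.  Turning around x from a face
    with an exit, whose entry is at b say, one crosses the edge xb and arrives
    at the exit face of b, again a face with an exit.  So all the
    faces at x are among the three faces with exits. *)
Lemma excess_eq2_degree : \sum_i excess S A i = 2 ->
  exists v, (#|[set i | v \in M i]| <= 3)%N.
Proof.
move=> ex2; have := excess_sum_ge; rewrite ex2 gerDl => le0.
have term0 i : (exits M S A i * (inside M A i).-1 = 0)%N /\ corners M S A i = 0%N.
  have : slack i <= 0.
    apply: le_trans le0; rewrite (bigD1 i) //= lerDl.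
    by apply: sumr_ge0 => j _; apply: slack_ge0.
  rewrite /slack.
  have c0 : 0 <= (corners M S A i)%:R :> rat by apply: ler0n.
  have xw0 : 0 <= (exits M S A i * (inside M A i).-1)%:R * face_width i.
    by rewrite mulr_ge0 ?ler0n // ltW // width_gt0.
  move=> t0; split; apply/eqP; rewrite -(lern0 rat); last by lra.
  by rewrite -(pmulr_lle0 _ (width_gt0 i)); lra.
have [a Sa] : exists a, a \in S by apply/card_gt0P; rewrite S3.
have [i0 ei0 _] := enters_unique omM cSAB S3 Sa.
have /and3P[ia0 _ Ax] := ei0; set x := nx i0 a in Ax.
exists x; pose special i := (0 < exits M S A i)%N.
have inside1 i u v : special i ->
    u \in M i -> v \in M i -> u \in A -> v \in A -> u = v.
  move=> sp iu iv Au Av; apply/eqP; apply: contraT => uv.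
  have : (2 <= inside M A i)%N.
    by rewrite /inside (bigD1 u) //= (bigD1 v) ?iv 1?eq_sym //= Au Av.
  by have [+ _] := term0 i; move: sp; rewrite /special; nia.
have no_corner b i : b \in S -> ~~ corner M A b i.
  move=> Sb; have [_ c0] := term0 i; apply/negP => cb.
  by move: c0; rewrite /corners (bigD1 b) //= cb.
have specialP b i : b \in S -> leaves M A b i \/ enters M A b i -> special i.
  move=> Sb [lb | eb]; first by rewrite /special exits_gt0; apply/exists_inP; exists b.
  rewrite /special (exits_entries omM cSAB) entries_gt0.
  by apply/exists_inP; exists b.
have all_special i : x \in M i -> special i.
  apply: (@turn_ind _ _ _ omM x special i0); rewrite ?mem_next //.
    by apply: (specialP a) => //; right.
  move=> {}i ix sp; have := sp.
  rewrite {1}/special (exits_entries omM cSAB) entries_gt0.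
  case/exists_inP=> b Sb eb; have /and3P[ib nAp An] := eb.
  have x_next : nx i b = x by apply: (inside1 i); rewrite ?mem_next.
  have [j lj _] := leaves_unique omM cSAB S3 Sb.
  have /and3P[jb Ap _] := lj.
  have turn_j : turn M b j = i.
    have [tb tn] := turnP omM jb.
    have := no_corner b (turn M b j) Sb.
    rewrite /corner tb tn Ap andbT /= => nAt.
    have [k _ uk] := enters_unique omM cSAB S3 Sb.
    by rewrite (uk i) // (uk (turn M b j)) // /enters tb nAt tn Ap.
  have [_ tn] := turnP omM jb; rewrite turn_j x_next in tn.
  rewrite (_ : turn M x i = j); first by apply: (specialP b) => //; left.
  apply: (turn_eq omM) => //; first by rewrite tn mem_prev.
  by rewrite tn (prevK omM) -tn -x_next (nextK omM).
apply: (@leq_trans #|[set i | special i]|).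
  by apply/subset_leq_card/subsetP => i; rewrite !inE => /all_special.
rewrite -sum1dep_card -(ler_nat rat) -sum_exits1 -natr_sum ler_nat.
by rewrite big_mkcond; apply: leq_sum => i _; rewrite /special; case: (exits _ _ _ _).
Qed.
End Cut.

(** The excess of each side is an even integer and at least 2, while both add up
    to at most 6; so one side has excess 2. *)
Theorem no_cut3 (S A B : {set V}) : flat -> wide ->
  (forall v, (3 < #|[set i | v \in M i]|)%N) -> #|S| = 3%N -> ~ cut M S A B.
Proof.
move=> flatM wideM deg4 S3 cSAB; have cSBA := cut_sym cSAB.
have ge4 (C D : {set V}) : cut M S C D -> 4 <= \sum_i excess S C i.
  move=> cut'; have [ex2|//] := excess_sum_cases cut' S3 flatM wideM.
  have [v] := excess_eq2_degree cut' S3 wideM ex2.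
  by have := deg4 v; lia.
have : \sum_i excess S A i + \sum_i excess S B i <=
    \sum_i (inside M S i)%:R * (1 / 2 - face_width i)
      + (\sum_i (exits M S A i)%:R + \sum_i (exits M S B i)%:R) / 2.
  rewrite -!big_split mulr_suml -big_split /=.
  by apply: ler_sum => i _; apply: excess_pair_le.
rewrite sum_angles // (sum_exits1 cSAB S3) (sum_exits1 cSBA S3) S3.
have := ge4 _ _ cSAB; have := ge4 _ _ cSBA; lra.
Qed.
End FlatMaps.

(** * Maps with given face-sequences *)

Local Open Scope nat_scope.

Lemma dihedral_perm (T : eqType) (s t : seq T) : dihedral s t -> perm_eq s t.
Proof.
case=> k [] ->; first by rewrite perm_sym perm_rot.
by rewrite perm_sym perm_rot perm_rev.
Qed.

(** Two stars of a vertex list the same faces, perhaps in different orders. *)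
Lemma has_fseq_perm (V I : eqType) (F : I -> seq V) v f g :
  has_fseq F v f -> has_fseq F v g -> perm_eq f g.
Proof.
move=> [s [_ Us sP _] /dihedral_perm fs] [t [_ Ut tP _] /dihedral_perm gt].
rewrite -(permPl fs) -(permPr gt); apply: perm_map.
by apply: uniq_perm => // i; rewrite sP tP.
Qed.

Lemma has_fseq_vertex (V I : eqType) (F : I -> seq V) v f :
  has_fseq F v f -> is_vertex F v.
Proof.
by case=> -[|i s] [// _ _ sP _] _; exists i; rewrite -sP mem_head.
Qed.

Lemma two_fseqs_perm (V I : eqType) (F : I -> seq V) f1 f2 g1 g2 f :
    two_fseqs F f1 f2 -> two_fseqs F g1 g2 -> f \in [:: f1; f2] ->
  exists2 g, g \in [:: g1; g2] & perm_eq f g.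
Proof.
move=> [_ [v1 fv1] [v2 fv2] _] [_ _ _ cover] f12.
have [v fv] : exists v, has_fseq F v f.
  by move: f12; rewrite !inE => /orP[] /eqP->; [exists v1 | exists v2].
have [gv | gv] := cover v (has_fseq_vertex fv).
  by exists g1; rewrite ?inE ?eqxx //; apply: has_fseq_perm fv gv.
by exists g2; rewrite ?inE ?eqxx ?orbT //; apply: has_fseq_perm fv gv.
Qed.

Section FaceSequences.
Variables (V I : finType) (M : I -> seq V).
Hypothesis omM : oriented_map M.

(** At every vertex the face sizes are those of a member of l, up to order. *)
Definition fseq_among (l : seq (seq nat)) : Prop :=
  forall v, exists2 f, f \in l &
    exists s, [/\ uniq s, forall i, (i \in s) = (v \in M i)
      & perm_eq [seq size (M i) | i <- s] f].

Lemma same_type_fseqs (W J : eqType) (F : J -> seq W) g1 g2 :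
  same_type M F -> two_fseqs F g1 g2 -> fseq_among [:: g1; g2].
Proof.
case=> f1 [L1 [f2 [L2 [[[_ _ _ coverM] _ _] [twoF _ _]]]]] twoG v.
have [f f12 fv] : exists2 f, f \in [:: f1; f2] & has_fseq M v f.
  have [i iv] := face_ex omM v.
  have [|fv|fv] := coverM v; first by exists i.
    by exists f1; rewrite ?inE ?eqxx.
  by exists f2; rewrite ?inE ?eqxx ?orbT.
have [g g12 fg] := two_fseqs_perm twoF twoG f12.
exists g => //; case: fv => s [_ Us sP _] /dihedral_perm sf.
by exists s; split; rewrite // (permPl sf).
Qed.

Lemma degree_fseq k l : fseq_among l -> all (fun f => k <= size f) l ->
  forall v, k <= #|[set i | v \in M i]|.
Proof.
move=> Ml /allP lk v; have [f lf [s [Us sP sf]]] := Ml v.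
apply: leq_trans (lk _ lf) _.
rewrite -(perm_size sf) size_map -(card_uniqP Us).
by apply/eq_leq/eq_card => i; rewrite inE sP.
Qed.

(** The faces at v have different successors of v, none of which is v. *)
Lemma degree_lt v : #|[set i | v \in M i]| < #|V|.
Proof.
have next_inj : {in [set i | v \in M i] &, injective (fun i => next (M i) v)}.
  by move=> i j; rewrite !inE => iv jv; apply: (om_coherent omM).
rewrite -(card_in_imset next_inj) -cardsT; apply: proper_card.
rewrite properE subsetT; apply/subsetPn; exists v; rewrite ?inE //.
apply/imsetP => -[i]; rewrite inE => iv v_next.
by have := next_neq omM iv; rewrite -v_next eqxx.
Qed.

Local Open Scope ring_scope.

Definition flat_fseq (f : seq nat) : Prop :=
  \sum_(p <- f) (1 / 2 - p%:R^-1) = 1 :> rat.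

(** Removing one occurrence of p before choosing q makes the pair (p, q) range
    over two different positions of f. *)
Definition wide_fseq (f : seq nat) : bool :=
  all (fun p => all (fun q => 1 / 3 <= p%:R^-1 + q%:R^-1 :> rat) (rem p f)) f.

Lemma flat_fseqs l :
  fseq_among l -> (forall f, f \in l -> flat_fseq f) -> flat M.
Proof.
move=> Ml lflat v; have [f lf [s [Us sP sf]]] := Ml v.
rewrite -[RHS](lflat _ lf) -(perm_big _ sf) big_map big_uniq //=.
by apply: eq_bigl => i; rewrite sP.
Qed.

Lemma wide_fseqs l : fseq_among l -> all wide_fseq l -> wide M.
Proof.
move=> Ml /allP lwide v i j iv jv ij; have [f lf [s [Us sP sf]]] := Ml v.
have si : i \in s by rewrite sP.
pose sz k := size (M k); have fi : sz i \in f by rewrite -(perm_mem sf) (map_f sz).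
have f_rem : perm_eq (rem (sz i) f) (map sz (rem i s)).
  rewrite -(perm_cons (sz i)) -(permPl (perm_to_rem fi)) -(permPl sf).
  by rewrite -map_cons (perm_map sz) // perm_to_rem.
have /allP/(_ _ fi)/allP := lwide _ lf; apply.
by rewrite (perm_mem f_rem) (map_f sz) // mem_rem_uniq // !inE eq_sym ij sP.
Qed.

End FaceSequences.

Local Open Scope ring_scope.

Lemma four_connected_fseqs g : g \in four_connected_tilings ->
  [/\ all (fun f => 3 < size f)%N [:: g.1; g.2],
      all wide_fseq [:: g.1; g.2]
    & forall f, f \in [:: g.1; g.2] -> flat_fseq f].
Proof.
move=> g_in; split.
- by move: g g_in; apply/allP.
- by move: g g_in; apply/allP; vm_compute.
(* Iterated sums do not compute, so they are traded for folds. *)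
suff /allP/(_ _ g_in)/andP[/eqP g1 /eqP g2] : all (fun g =>
  (foldr (fun p x => 1 / 2 - p%:R^-1 + x) 0 g.1 == 1 :> rat) &&
  (foldr (fun p x => 1 / 2 - p%:R^-1 + x) 0 g.2 == 1 :> rat))
  four_connected_tilings.
  move=> f; rewrite !inE /flat_fseq unlock => /orP[] /eqP->; [exact: g1 | exact: g2].
by vm_compute.
Qed.

Local Open Scope nat_scope.

Theorem theorem1p2 (R : realType)
    (V I : finType) (M : I -> seq V)
    (J : eqType) (T : J -> seq (R * R)) :
  torus_map M -> doubly_semi_equivelar M ->
  two_uniform T -> same_type M T ->
  (tiling_among T four_connected_tilings -> map_k_connected M 4) /\
  (tiling_among T three_connected_tilings -> map_k_connected M 3).
Proof.
move=> [omM _] _ _ typeMT.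
have [v0 _] := card_gt0P (om_nonempty omM).
split=> -[g g_in two_g]; have Mg := same_type_fseqs omM typeMT two_g.
  have [deg wideg flatg] := four_connected_fseqs g_in.
  have deg4 := degree_fseq Mg deg.
  apply: no_cut_k_connected => [|S A B S3].
    by apply: leq_ltn_trans (degree_lt omM v0); apply: deg4.
  exact: (no_cut3 omM (flat_fseqs Mg flatg) (wide_fseqs Mg wideg) deg4 S3).
have deg : all (fun f => 2 < size f)%N [:: g.1; g.2].
  by move: g g_in {two_g Mg}; apply/allP.
apply: no_cut_k_connected => [|S A B S2 /(cut_size_ge3 omM)]; last by rewrite S2.
by apply: leq_ltn_trans (degree_lt omM v0); apply: (degree_fseq Mg deg).
Qed.
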